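(* Let $\mathbf{Q}$ be a real $m\times n$ matrix with orthonormal rows, $\mathbf{Q}\mathbf{Q}^T=\mathbf{I}_m$, and coherence $\mu$, and let $\mathbf{Q}\mathbf{S}$ be computed by the sampling algorithm (described in the context) with $c$ samples. Given $0<\epsilon<1$ and $0<\delta<1$, we have $$\kappa(\mathbf{Q}\mathbf{S})\leq\frac{\sqrt{1+\epsilon}}{\sqrt{1-\epsilon}}$$ with probability at least $1-\delta$, if the algorithm (i) either samples with ``nearly optimal'' probabilities $p_j^{\beta}$ (independently, with replacement), where $0<\beta\leq 1$, $\sum_{j=1}^n p_j^{\beta}=1$ and $p_j^{\beta}\geq\beta\,\|Q_j\|_2^2/\|\mathbf{Q}\|_F^2$ for $1\leq j\leq n$, and $$c\geq c_2(\epsilon)\,m\,\frac{\ln(2m/\delta)}{\beta\,\epsilon^2},$$ (ii) or samples with uniform probabilities $1/n$, with or without replacement, and $$c\geq c_2(\epsilon)\,n\,\mu\,\frac{\ln(2m/\delta)}{\epsilon^2}.$$ Here $c_2(\epsilon)\equiv\dfrac{\epsilon^2}{(1+\epsilon)\ln(1+\epsilon)-\epsilon}$, and $2\leq c_2(\epsilon)\leq 2.6$.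
   Context: $Q_1,\ldots,Q_n$ are the columns of $\mathbf{Q}$; the coherence of $\mathbf{Q}$ is $\mu\equiv\max_{1\leq j\leq n}\|Q_j\|_2^2$. $\sigma_1(\mathbf{Q}\mathbf{S})$ and $\sigma_m(\mathbf{Q}\mathbf{S})$ denote the largest and $m$-th largest singular values of the $m\times c$ matrix $\mathbf{Q}\mathbf{S}$, i.e. the square roots of the largest and smallest eigenvalues of $(\mathbf{Q}\mathbf{S})(\mathbf{Q}\mathbf{S})^T$. The two-norm condition number with respect to left inversion is $\kappa(\mathbf{Q}\mathbf{S})\equiv\sigma_1(\mathbf{Q}\mathbf{S})/\sigma_m(\mathbf{Q}\mathbf{S})$, defined when $\mathbf{Q}\mathbf{S}$ has full row rank (a bound on $\kappa(\mathbf{Q}\mathbf{S})$ is understood to include $\sigma_m(\mathbf{Q}\mathbf{S})>0$). $\|\cdot\|_2$ is the two-norm and $\|\cdot\|_F$ the Frobenius norm. Sampling algorithm: given $\mathbf{Q}$, a number of samples $1\leq c\leq n$ and probabilities $p_j\geq 0$ with $\sum_{j=1}^n p_j=1$, sample indices $t_1,\ldots,t_c$ from $\{1,\ldots,n\}$ independently and with replacement, with $\mathbb{P}[t_j=i]=p_i$; let $\mathbf{S}$ be the $n\times c$ matrix with columns $e_{t_j}/\sqrt{c\,p_{t_j}}$, where $e_i$ are the columns of $\mathbf{I}_n$. An index $i$ with $p_i=0$ is never selected. Uniform sampling without replacement means that $(t_1,\ldots,t_c)$ is instead a uniformly random sequence of $c$ distinct indices, with the same definition of $\mathbf{S}$ using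 $p_j=1/n$. *)

(* Defs.v *)
From HB Require Import structures.
From mathcomp Require Import all_boot all_order all_algebra.
From mathcomp Require Import all_classical all_reals all_analysis.

Set Implicit Arguments.
Unset Strict Implicit.
Unset Printing Implicit Defensive.

Import Order.TTheory GRing.Theory Num.Theory.
Local Open Scope classical_set_scope.
Local Open Scope ring_scope.

(* The norm instances of MathComp-Analysis on matrices are sup norms, so the
   Euclidean and Frobenius norms are defined here. *)
Definition norm2 (R : realType) (k : nat) (v : 'cV[R]_k) : R :=
  Num.sqrt (\sum_(i < k) v i 0 ^+ 2).

Definition normF (R : realType) (m n : nat) (A : 'M[R]_(m, n)) : R :=
  Num.sqrt (\sum_(i < m) \sum_(j < n) A i j ^+ 2).

Definition coherence (R : realType) (m n : nat) (Q : 'M[R]_(m, n)) : R :=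
  \big[Num.max/0]_(j < n) norm2 (col j Q) ^+ 2.

(* For 0 < m the spectrum of the symmetric matrix A *m A^T is finite and
   nonempty, so the supremum and infimum below are its largest and smallest
   elements; both are nonnegative.  For m = 0 these are junk values. *)
Definition spectrum (R : realType) (m : nat) (A : 'M[R]_m) : set R :=
  [set a | eigenvalue A a].

Definition sigma_max (R : realType) (m c : nat) (A : 'M[R]_(m, c)) : R :=
  Num.sqrt (sup (spectrum (A *m A^T))).

Definition sigma_min (R : realType) (m c : nat) (A : 'M[R]_(m, c)) : R :=
  Num.sqrt (inf (spectrum (A *m A^T))).

(* Only meaningful when 0 < sigma_min A, i.e. when A has full row rank. *)
Definition kappa (R : realType) (m c : nat) (A : 'M[R]_(m, c)) : R :=
  sigma_max A / sigma_min A.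

(* Column j is e_(s j) / sqrt (c * p (s j)).  An index i with p i = 0 would give
   a zero column (0^-1 = 0), but is selected with probability 0. *)
Definition sampling_mx (R : realType) (n c : nat) (p : 'I_n -> R)
    (s : 'I_c -> 'I_n) : 'M[R]_(n, c) :=
  \matrix_(i < n, j < c) ((i == s j)%:R / Num.sqrt (c%:R * p (s j))).

Definition prob_vector (R : realType) (n : nat) (p : 'I_n -> R) : Prop :=
  (forall j, 0 <= p j) /\ \sum_(j < n) p j = 1.

(* Random variables with values in 'I_n carrying the discrete sigma-algebra. *)
Definition index_RV (d : measure_display) (T : measurableType d) (n : nat)
    (X : T -> 'I_n) : Prop :=
  forall A : set 'I_n, measurable (X @^-1` A).

Definition mutually_independent (d : measure_display) (T : measurableType d)
    (R : realType) (P : probability T R) (n c : nat)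
    (t : 'I_c -> T -> 'I_n) : Prop :=
  forall (J : {set 'I_c}) (A : 'I_c -> set 'I_n),
    P [set w | forall j, j \in J -> A j (t j w)] =
    (\prod_(j in J) P (t j @^-1` A j))%E.

Definition samples_with_replacement (d : measure_display)
    (T : measurableType d) (R : realType) (P : probability T R) (n c : nat)
    (p : 'I_n -> R) (t : 'I_c -> T -> 'I_n) : Prop :=
  [/\ forall j, index_RV (t j),
      mutually_independent P t
    & forall j i, P (t j @^-1` [set i]) = (p i)%:E].

(* (t_1, ..., t_c) is uniform on the n ^_ c sequences of c distinct indices. *)
Definition samples_without_replacement (d : measure_display)
    (T : measurableType d) (R : realType) (P : probability T R) (n c : nat)
    (t : 'I_c -> T -> 'I_n) : Prop :=
  (forall j, index_RV (t j)) /\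
  forall s : {ffun 'I_c -> 'I_n},
    P [set w | forall j, t j w = s j] =
    (if injectiveb s then (n ^_ c)%:R^-1 else 0)%:E.

Definition uniform_weights (R : realType) (n : nat) : 'I_n -> R :=
  fun=> n%:R^-1.

Definition c2 (R : realType) (eps : R) : R :=
  eps ^+ 2 / ((1 + eps) * ln (1 + eps) - eps).

(* The event that Q S has full row rank and kappa (Q S) is at most
   sqrt (1 + eps) / sqrt (1 - eps), for S sampled by t with scaling p. *)
Definition well_conditioned (d : measure_display) (T : measurableType d)
    (R : realType) (m n c : nat) (Q : 'M[R]_(m, n)) (p : 'I_n -> R)
    (t : 'I_c -> T -> 'I_n) (eps : R) : set T :=
  [set w | let QS := Q *m sampling_mx p (fun j => t j w) in
     0 < sigma_min QS /\
     kappa QS <= Num.sqrt (1 + eps) / Num.sqrt (1 - eps)].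

(* Main.v *)
Require Import Defs.
From HB Require Import structures.
From mathcomp Require Import all_boot all_order all_algebra.
From mathcomp Require Import all_classical all_reals all_analysis.
From mathcomp Require Import zify ring lra complex.

(** The matrix (Q S)(Q S)^T is a sum G of c random rank-one matrices x x^T with
    |x|^2 <= ell whose mean is the identity, and the theorem says that all its
    eigenvalues lie in [1 - eps, 1 + eps] with probability at least 1 - delta.
    This is a matrix Chernoff bound.  The usual proof controls the potential
    tr exp (theta G) by the Golden-Thompson inequality; here the exponential is
    replaced by the polynomial potential tr (1 + r G)^N with r = theta / N, for
    even N tending to infinity, and everything becomes algebra of positive
    semidefinite forms.

    One-step bound.  With A = 1 + r G and B = A + r x x^T the difference
    tr B^N - tr A^N is r times a sum of mixed moments x^T B^j A^i x
    ([trace_rank_one]), which obey a recursion in j.  The moments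
    a_k = x^T A^k x form a log-convex sequence, hence a_i a_j <= a_0 a_(i+j)
    ([moment_supermul]), and this turns the recursion into a bound on the
    potential of B by tr A^N + g r x^T A^N x.  For r > 0
    ([trace_rank_one_upper]) one gets g r at most (exp (theta ell) - 1) / ell.
    For r < 0, with r = - theta / N ([trace_rank_one_lower]), g r tends to the
    second-order value - theta + theta^2 ell / 2.  This is weaker than the
    exponential but gives the lower tail the rate eps^2 / 2, which is at least
    the rate (1 + eps) ln (1 + eps) - eps of the upper tail.

    Expectation.  For independent samples the mean of x x^T is 1 / c, so each
    draw multiplies the expected potential by at most 1 + g r / c
    ([expected_potential_replacement]).  Without replacement the mean of the next
    term given the past is (n / c - G) / (n - k); the correction involves
    tr A^N (k / c - G), which commutes, has the favourable sign after a Chebyshev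
    inequality ([trace_chebyshev]) and averages out because tr G has mean
    k m / c ([expected_potential_uniq]).  So both schemes satisfy the same bound
    m exp (g r).

    Markov's inequality with theta = ln (1 + eps) / ell, respectively
    theta = eps / ell, followed by N to infinity, bounds each tail by
    m exp (- rate / ell) <= delta / 2 ([upper_tail], [lower_tail]).  The probability
    space enters only through the law of the sampled tuple of indices
    ([prob_sample]). *)

Set Implicit Arguments.
Unset Strict Implicit.
Unset Printing Implicit Defensive.

Import Order.TTheory GRing.Theory Num.Theory.
Local Open Scope classical_set_scope.
Local Open Scope ring_scope.

(** * Positive semidefinite forms, moments and rank-one updates *)

Section QuadraticForms.
Variables (R : realType) (m : nat).
Implicit Types (A B : 'M[R]_m) (x y : 'cV[R]_m).

Definition bform A x y : R := \tr (x^T *m A *m y).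

Definition psd A := A^T = A /\ forall x, 0 <= bform A x x.

Lemma bformDm A B x y : bform (A + B) x y = bform A x y + bform B x y.
Proof. by rewrite /bform mulmxDr mulmxDl mxtraceD. Qed.

Lemma bformZm a A x y : bform (a *: A) x y = a * bform A x y.
Proof. by rewrite /bform -scalemxAr -scalemxAl /= mxtraceZ. Qed.

Lemma bformDr A x y z : bform A x (y + z) = bform A x y + bform A x z.
Proof. by rewrite /bform mulmxDr mxtraceD. Qed.

Lemma bformZr A a x y : bform A x (a *: y) = a * bform A x y.
Proof. by rewrite /bform -scalemxAr mxtraceZ. Qed.

Lemma bformC A x y : A^T = A -> bform A y x = bform A x y.
Proof. by move=> sA; rewrite /bform -mxtrace_tr !trmx_mul trmxK sA mulmxA. Qed.

Lemma bform_suml (I : Type) (r : seq I) (F : I -> 'M[R]_m) x y :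
  bform (\sum_(i <- r) F i) x y = \sum_(i <- r) bform (F i) x y.
Proof.
elim: r => [|i r IH]; last by rewrite !big_cons bformDm IH.
by rewrite !big_nil /bform mulmx0 mul0mx mxtrace0.
Qed.

Lemma mxtrace_bform A x y : \tr (A *m (y *m x^T)) = bform A x y.
Proof. by rewrite mulmxA mxtrace_mulC /bform mulmxA. Qed.

Lemma bformM A B x y : A^T = A -> bform (A * B) x y = bform B (A *m x) y.
Proof. by move=> sA; rewrite /bform trmx_mul sA -!mulmxE !mulmxA. Qed.

Lemma bformMr A B x y : bform (A * B) x y = bform A x (B *m y).
Proof. by rewrite /bform -!mulmxE !mulmxA. Qed.

Lemma bform1_sum x : bform 1 x x = \sum_i x i 0 ^+ 2.
Proof.
rewrite /bform mulmx1 trace_mx11 mxE; apply: eq_bigr => i _.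
by rewrite mxE expr2.
Qed.

Lemma bform1_ge0 x : 0 <= bform 1 x x.
Proof. by rewrite bform1_sum sumr_ge0 // => i _; exact: sqr_ge0. Qed.

Lemma bform1_eq0 x : bform 1 x x = 0 -> x = 0.
Proof.
rewrite bform1_sum => /eqP; rewrite psumr_eq0; last first.
  by move=> i _; exact: sqr_ge0.
move=> /allP x0; apply/colP => i; rewrite mxE.
by have := x0 i; rewrite mem_index_enum sqrf_eq0 => /(_ isT)/eqP.
Qed.

Lemma trmx_exp A k : A^T = A -> (A ^+ k)^T = A ^+ k.
Proof.
move=> sA; elim: k => [|k IH]; first by rewrite !expr0 trmx1.
by rewrite {1}exprS -mulmxE trmx_mul IH sA mulmxE exprSr.
Qed.

Lemma psd1 : psd 1.
Proof.
split=> [|x]; first by rewrite trmx1.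
exact: bform1_ge0.
Qed.

(** An even power is B^T B and an odd one is B^T A B, with B a power of A. *)
Lemma psd_exp A k : psd A -> psd (A ^+ k).
Proof.
move=> [sA pA]; have sAk h := trmx_exp h sA; split=> // x.
rewrite -(odd_double_half k); set h := k./2; rewrite -addnn.
case: (odd k) => /=.
- have -> : A ^+ (true + (h + h)) = A ^+ h * (A * A ^+ h).
    by rewrite -exprS -exprD addnS.
  by rewrite bformM // bformMr.
- by rewrite add0n exprD bformM // -[X in bform X]mul1r bformMr bform1_ge0.
Qed.

Lemma bform_comb A a b x y : A^T = A ->
  bform A (a *: x + b *: y) (a *: x + b *: y) =
  a ^+ 2 * bform A x x + 2 * a * b * bform A x y + b ^+ 2 * bform A y y.
Proof.
move=> sA; rewrite bformDr !bformZr.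
rewrite !(bformC _ (a *: x + b *: y)) // !bformDr !bformZr (bformC x y) //.
by ring.
Qed.

(** Expanding the nonnegative form at w x - v y, where v = x^T A y and
    w = y^T A y, gives w (u w - v^2) with u = x^T A x; symmetrically for u.  When
    u = w = 0 the vector x - v y forces v = 0. *)
Lemma bform_CS A x y : psd A ->
  bform A x y ^+ 2 <= bform A x x * bform A y y.
Proof.
move=> [sA pA].
have q a b : 0 <= a ^+ 2 * bform A x x + 2 * a * b * bform A x y
                  + b ^+ 2 * bform A y y by rewrite -bform_comb.
have := pA x; have := pA y.
move: (bform A x x) (bform A x y) (bform A y y) q => u v w q w0 u0.
move: w0; rewrite le0r => /orP[/eqP w0|w_gt0]; last first.
  have := q w (- v); rewrite (_ : _ + _ = w * (u * w - v ^+ 2)); last by ring.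
  by rewrite pmulr_rge0 // subr_ge0.
move: u0; rewrite le0r => /orP[/eqP u0|u_gt0]; last first.
  have := q (- v) u; rewrite (_ : _ + _ = u * (u * w - v ^+ 2)); last by ring.
  by rewrite pmulr_rge0 // subr_ge0.
have := q 1 (- v); rewrite u0 w0; lra.
Qed.

Definition moment A x k : R := bform (A ^+ k) x x.

Lemma moment_ge0 A x k : psd A -> 0 <= moment A x k.
Proof. by move=> /(psd_exp k)[_]; apply. Qed.

Lemma moment0 A x : moment A x 0 = bform 1 x x.
Proof. by rewrite /moment expr0. Qed.

(** Cauchy-Schwarz for the form A^k at the vectors x and A x. *)
Lemma moment_logconvex A x k : psd A ->
  moment A x k.+1 ^+ 2 <= moment A x k * moment A x k.+2.
Proof.
move=> pA; have [sA _] := pA; have pAk := psd_exp k pA.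
rewrite /moment [A ^+ k.+1]exprSr bformMr.
have -> : A ^+ k.+2 = A * (A ^+ k * A) by rewrite exprS exprSr.
by rewrite bformM // bformMr; exact: bform_CS.
Qed.

(** By log-convexity the ratios a_(k+1) / a_k are nondecreasing, so the
    product a_(i+j) / a_j of i consecutive ratios starting at j is at least the
    product a_i / a_0 of the first i.  For the spectral measure of A at x this
    is Chebyshev's association inequality. *)
Lemma moment_supermul A x i j : psd A ->
  moment A x i * moment A x j <= moment A x 0 * moment A x (i + j).
Proof.
move=> pA; have a_ge0 k := moment_ge0 x k pA.
have lc k := moment_logconvex x k pA.
move: (moment A x) a_ge0 lc => a a0 lc.
have ratio k l : a k.+1 * a (k + l)%N <= a k * a (k + l).+1.
  elim: l => [|l IH]; first by rewrite addn0 mulrC.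
  rewrite addnS; have := a0 (k + l)%N; rewrite le0r => /orP[/eqP z|p].
    have -> : a (k + l).+1 = 0.
      have := lc (k + l)%N; rewrite z mul0r => le0.
      by apply/eqP; rewrite -sqrf_eq0 eq_le le0 sqr_ge0.
    by rewrite mulr0 mulr_ge0.
  rewrite -(ler_pM2r p) mulrAC; apply: (le_trans (ler_wpM2r (a0 _) IH)).
  by rewrite -!mulrA ler_wpM2l // -expr2 mulrC.
elim: i => [|i IH]; first by rewrite add0n.
have := a0 i; rewrite le0r => /orP[/eqP z|p].
  have -> : a i.+1 = 0.
    have := lc i; rewrite z mul0r => le0.
    by apply/eqP; rewrite -sqrf_eq0 eq_le le0 sqr_ge0.
  by rewrite mul0r mulr_ge0.
rewrite -(ler_pM2l p) mulrCA [a i * _]mulrC.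
apply: (@le_trans _ _ (a i.+1 * (a 0%N * a (i + j)%N))).
  by rewrite ler_wpM2l // mulrC.
by rewrite mulrCA [leRHS]mulrCA ler_wpM2l // addSn; exact: ratio.
Qed.

(** The first ratio a_1 / a_0 is at least kap, and later ratios are larger. *)
Lemma moment_lower_growth A x kap k : psd A ->
  kap * bform 1 x x <= bform A x x -> kap * moment A x k <= moment A x k.+1.
Proof.
move=> pA lb; have := bform1_ge0 x; rewrite le0r => /orP[/eqP/bform1_eq0->|p].
  have z B : bform B 0 0 = 0 by rewrite /bform mulmx0 mxtrace0.
  by rewrite /moment !z mulr0.
rewrite -(ler_pM2l p) mulrCA mulrA.
apply: (le_trans (ler_wpM2r (moment_ge0 x k pA) lb)).
have := moment_supermul x 1 k pA; rewrite /moment expr1 expr0.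
by rewrite add1n.
Qed.

(** With y = A^h x the claim reads |A y|^2 <= y^T A y.  Cauchy-Schwarz for the
    form A at y and A y bounds |A y|^4 by (y^T A y) ((A y)^T A (A y)), and the
    last factor is at most |A y|^2. *)
Lemma moment_contraction A x h : psd A ->
  (forall y, bform A y y <= bform 1 y y) ->
  moment A x h.*2.+2 <= moment A x h.*2.+1.
Proof.
move=> pA ub; have [sA pA'] := pA.
have sAh := trmx_exp h sA.
set y := A ^+ h *m x; set z := A *m y.
have -> : moment A x h.*2.+1 = bform A y y.
  rewrite /moment (_ : A ^+ _ = A ^+ h * (A * A ^+ h)).
    by rewrite bformM // bformMr.
  by rewrite -exprS -exprD addnS addnn.
have -> : moment A x h.*2.+2 = bform 1 z z.
  rewrite /moment (_ : A ^+ _ = A ^+ h * (A * (1 * (A * A ^+ h)))).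
    by rewrite bformM // bformM // bformMr -!mulmxE -mulmxA.
  by rewrite mul1r -!exprS -exprD !addnS addnn.
have cs := bform_CS y z pA.
have yz : bform A y z = bform 1 z z by rewrite -[A]mulr1 bformM.
rewrite yz in cs.
have := bform1_ge0 z; rewrite le0r => /orP[/eqP->//|p].
rewrite -(ler_pM2r p) -expr2; apply: (le_trans cs).
by rewrite ler_wpM2l.
Qed.

Lemma exprB_telescope A B N :
  B ^+ N - A ^+ N = \sum_(j < N) A ^+ (N - 1 - j) * (B - A) * B ^+ j.
Proof.
elim: N => [|N IH]; first by rewrite big_ord0 !expr0 subrr.
rewrite big_ord_recr /= subn1 /= subnn expr0 mul1r.
have -> : \sum_(i < N) A ^+ (N - i) * (B - A) * B ^+ i = A * (B ^+ N - A ^+ N).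
  rewrite IH mulr_sumr; apply: eq_bigr => i _; rewrite !mulrA -exprS.
  by congr (A ^+ _ * _ * _); have := ltn_ord i; rewrite -subnDA add1n; lia.
by rewrite mulrBr mulrBl !exprS [RHS]addrC addrA subrK.
Qed.

Lemma mxtrace_mul11 (u v : 'M[R]_1) : \tr (u *m v) = \tr u * \tr v.
Proof. by rewrite !trace_mx11 mxE big_ord1. Qed.

Section RankOneUpdate.
Variables (A : 'M[R]_m) (x : 'cV[R]_m) (r : R).
Let B := A + r *: (x *m x^T).
Let f i j := bform (B ^+ j * A ^+ i) x x.

(** Peeling one factor B = A + r x x^T off B^(j+1) either moves it to the power
    of A, or cuts the word at the rank-one matrix into two scalar factors. *)
Lemma mixed_moment_rec i j : f i j.+1 = f i.+1 j + r * (f 0 j * moment A x i).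
Proof.
rewrite /f exprSr -mulrA {2}/B mulrDl mulrDr bformDm -exprS; congr (_ + _).
rewrite -!mulmxE -scalemxAl -scalemxAr bformZm expr0 mulmx1.
congr (_ * _).
by rewrite /moment /bform -mxtrace_mul11 !mulmxA.
Qed.

Lemma trace_rank_one N :
  \tr (B ^+ N) = \tr (A ^+ N) + r * \sum_(j < N) f (N - 1 - j) j.
Proof.
apply/eqP; rewrite addrC -subr_eq -raddfB /= exprB_telescope raddf_sum mulr_sumr.
apply/eqP/eq_bigr => j _; rewrite /B addrAC subrr add0r -!mulmxE -scalemxAr -scalemxAl /= mxtraceZ.
congr (_ * _); rewrite /f -mxtrace_bform [LHS]mxtrace_mulC -!mulmxE.
by rewrite !mulmxA.
Qed.

Hypothesis psdA : psd A.

(** Substitute for Golden-Thompson at r >= 0: by induction on j every cut costs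
    a factor at most q = 1 + r |x|^2, that is f i j <= q^j a_(i+j).  Since A >= 1
    the moments increase, so the index lost at a cut can be restored. *)
Lemma trace_rank_one_upper N :
  0 <= r -> (forall y, bform 1 y y <= bform A y y) ->
  \tr (B ^+ N) <= \tr (A ^+ N)
    + r * (\sum_(j < N) (1 + r * bform 1 x x) ^+ j) * moment A x N.
Proof.
move=> r0 A1; have a0 k := moment_ge0 x k psdA.
set q := 1 + r * bform 1 x x.
have q0 : 0 <= q by rewrite addr_ge0 // mulr_ge0 ?bform1_ge0.
have grow k : moment A x k <= moment A x k.+1.
  rewrite -[leLHS]mul1r; apply: moment_lower_growth => //.
  by rewrite mul1r.
have fub j : forall i, f i j <= q ^+ j * moment A x (i + j).
  elim: j => [|j IH] i; first by rewrite /f !expr0 !mul1r addn0.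
  rewrite mixed_moment_rec exprSr -mulrA [q * _]mulrDl mul1r mulrDr lerD //.
    by rewrite -addSnnS; exact: IH.
  rewrite [leRHS](_ : _ =
    r * (q ^+ j * (bform 1 x x * moment A x (i + j.+1)))); last by ring.
  apply: ler_wpM2l => //.
  apply: (le_trans (ler_wpM2r (a0 i) (IH 0%N))); rewrite add0n -mulrA.
  rewrite ler_wpM2l ?exprn_ge0 // mulrC; apply: (le_trans (moment_supermul _ _ _ psdA)).
  by rewrite moment0 ler_wpM2l ?bform1_ge0 // addnS; exact: grow.
rewrite trace_rank_one lerD2l -mulrA; apply: ler_wpM2l => //.
rewrite mulr_suml; apply: ler_sum => j _; apply: (le_trans (fub _ _)).
rewrite ler_wpM2l ?exprn_ge0 //; have jN := ltn_ord j.
have -> : (N - 1 - j + j = N.-1)%N by lia.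
by case: (N) => [|k] /=.
Qed.

(** For r <= 0 the cuts have negative sign.  They are bounded by their value at
    first order, replacing f 0 j by a_j (valid since B is positive
    semidefinite), and kap <= A pays for the index lost at a cut.  Summing over
    the N positions leaves a second-order Bernstein bound, in which a_N <= a_(N-1)
    by [moment_contraction] as N is even. *)
Lemma trace_rank_one_lower N kap ell :
  r <= 0 -> 0 < kap -> psd B -> bform 1 x x <= ell ->
  (forall y, kap * bform 1 y y <= bform A y y) ->
  (forall y, bform A y y <= bform 1 y y) ->
  ~~ odd N -> 0 <= kap + r * ell * N%:R / 2 ->
  \tr (B ^+ N) <= \tr (A ^+ N)
    + r * (N%:R * (1 + r * ell * N%:R / (2 * kap))) * moment A x N.
Proof.
move=> r0 k0 psdB xl Ak A1 evN G0; have a0 k := moment_ge0 x k psdA.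
have fub j : forall i, f i j <= moment A x (i + j).
  elim: j => [|j IH] i; first by rewrite /f !expr0 mul1r addn0.
  rewrite mixed_moment_rec addnS -addSn -[leRHS]addr0 lerD //.
  rewrite mulr_le0_ge0 // mulr_ge0 //.
  by rewrite /f expr0 mulr1; exact: moment_ge0.
have flb j : forall i, (kap + j%:R * (r * ell)) * moment A x (i + j) <= kap * f i j.
  elim: j => [|j IH] i; first by rewrite mul0r addr0 /f expr0 mul1r addn0.
  rewrite mixed_moment_rec mulrDr -natr1 (mulrDl j%:R) mul1r addrA mulrDl lerD //.
    by rewrite addnS -addSn.
  rewrite mulrCA -mulrA ler_wnM2l //.
  apply: (le_trans (ler_wpM2l (ltW k0) (ler_wpM2r (a0 i) (fub j 0%N)))).
  rewrite add0n [_ * moment A x i]mulrC.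
  apply: (le_trans (ler_wpM2l (ltW k0) (moment_supermul x i j psdA))).
  rewrite moment0 mulrCA; apply: ler_pM; rewrite ?bform1_ge0 //.
    by rewrite mulr_ge0 // ltW.
  by rewrite addnS; exact: moment_lower_growth.
rewrite trace_rank_one lerD2l -mulrA; apply: ler_wnM2l => //.
rewrite -(ler_pM2l k0) [leRHS]mulr_sumr.
apply: (@le_trans _ _ (\sum_(j < N) (kap + j%:R * (r * ell)) * moment A x N.-1));
  last first.
  apply: ler_sum => j _; have jN := ltn_ord j.
  have -> : (N.-1 = N - 1 - j + j)%N by lia.
  exact: flb.
rewrite -mulr_suml big_split /= sumr_const card_ord -mulr_suml.
have -> : \sum_(i < N) (i%:R : R) = N%:R * (N%:R - 1) / 2.
  elim: (N) => [|k IH]; first by rewrite big_ord0 !mul0r.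
  by rewrite big_ord_recr /= IH -natr1; field.
case: N evN G0 => [|N] evN G0; first by rewrite mulr0n !mul0r mulr0 addr0 mul0r.
have Nup : moment A x N.+1 <= moment A x N.
  case: N evN {G0} => [|N]; first by [].
  rewrite /= !negbK => /negbTE evN.
  by rewrite -(odd_double_half N) evN add0n; exact: moment_contraction.
set M := N.+1%:R; rewrite -/M in G0.
have M0 : 0 <= M :> R by rewrite /M.
have rl0 : r * ell <= 0.
  by rewrite mulr_le0_ge0 // (le_trans (bform1_ge0 x)).
apply: (@le_trans _ _ (M * (kap + r * ell * M / 2) * moment A x N)).
  have -> : kap * (M * (1 + r * ell * M / (2 * kap)) * moment A x N.+1) =
            M * (kap + r * ell * M / 2) * moment A x N.+1.
    by field; rewrite gt_eqF.
  by rewrite ler_wpM2l // mulr_ge0.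
rewrite ler_wpM2r //= -mulr_natl -/M.
rewrite -subr_ge0 (_ : _ - _ = (- (r * ell)) * M / 2); last by field.
by rewrite divr_ge0 // mulr_ge0 // oppr_ge0.
Qed.
End RankOneUpdate.
End QuadraticForms.

(** * Eigenvalues of symmetric matrices *)

Section SymmetricEigenvalues.
Variables (R : realType) (m : nat).
Implicit Types A : 'M[R]_m.

(** A complex eigenvector a + i b with eigenvalue x + i y exists; comparing
    a A b^T with its transpose gives y (|a|^2 + |b|^2) = 0, so y = 0 and one of
    a, b is a real eigenvector. *)
Lemma symmetric_eigenvalue A : (0 < m)%N -> A^T = A -> exists a, eigenvalue A a.
Proof.
move=> m_gt0 sA.
have [z /eigenvalueP[v vA v0]] :=
  complex.Theorem7' (map_mx (@complex.real_complex_def R (Phant R)) A) m_gt0.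
pose a := map_mx (@complex.Re R) v; pose b := map_mx (@complex.Im R) v.
pose x := complex.Re z; pose y := complex.Im z.
have vE i : v 0 i = complex.Complex (a 0 i) (b 0 i) by rewrite !mxE; case: (v 0 i).
have ReD : {morph @complex.Re R : u w / u + w >-> u + w} by move=> [? ?] [? ?].
have ImD : {morph @complex.Im R : u w / u + w >-> u + w} by move=> [? ?] [? ?].
have aA : a *m A = x *: a - y *: b.
  apply/rowP => i; have := congr1 (fun w : 'rV_m => complex.Re (w 0 i)) vA.
  rewrite !mxE (big_morph _ ReD (erefl _)) /= vE /x /y; case: (z) => z1 z2 /= <-.
  by apply: eq_bigr => j _; rewrite !mxE; case: (v 0 j) => ? ? /=; ring.
have bA : b *m A = x *: b + y *: a.
  apply/rowP => i; have := congr1 (fun w : 'rV_m => complex.Im (w 0 i)) vA.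
  rewrite !mxE (big_morph _ ImD (erefl _)) /= vE /x /y; case: (z) => z1 z2 /= <-.
  by apply: eq_bigr => j _; rewrite !mxE; case: (v 0 j) => ? ? /=; ring.
have y0 : y * (bform 1 a^T a^T + bform 1 b^T b^T) = 0.
  have : \tr (a *m A *m b^T) = \tr (b *m A *m a^T).
    by rewrite -mxtrace_tr !trmx_mul trmxK sA mulmxA.
  rewrite aA bA /bform !mulmx1 !trmxK mulmxBl mulmxDl -!scalemxAl.
  rewrite linearB linearD /= !mxtraceZ -(mxtrace_tr (b *m a^T)) trmx_mul trmxK.
  by move=> e; rewrite mulrDr; lra.
have ab0 : bform 1 a^T a^T + bform 1 b^T b^T != 0.
  apply: contraNneq v0 => ab; have := bform1_ge0 a^T; have := bform1_ge0 b^T.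
  move=> qb qa.
  have /bform1_eq0/(congr1 trmx) : bform 1 a^T a^T = 0 by lra.
  have /bform1_eq0/(congr1 trmx) : bform 1 b^T b^T = 0 by lra.
  rewrite !trmxK !trmx0 => b0 a0; apply/eqP/rowP => i.
  by rewrite vE a0 b0 !mxE.
move/eqP: y0; rewrite mulf_eq0 (negbTE ab0) orbF => /eqP y0.
move: aA bA; rewrite y0 !scale0r subr0 addr0 => aA bA.
exists x; apply/eigenvalueP.
have [a0|an0] := eqVneq a 0; last by exists a.
exists b => //; apply: contraNneq ab0 => b0.
by rewrite a0 b0 trmx0 /bform !mulmx0 mxtrace0 addr0.
Qed.

Lemma eigenvalue_shift A r a :
  eigenvalue A a -> eigenvalue (1 + r *: A) (1 + r * a).
Proof.
move=> /eigenvalueP[v vA v0]; apply/eigenvalueP; exists v => //.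
by rewrite mulmxDr mulmx1 -scalemxAr vA scalerA scalerDl scale1r.
Qed.

(** For N = 2 k and B = A^k, the trace of A^N is the squared Frobenius norm of
    B, which dominates |v B|^2 / |v|^2 = a^N. *)
Lemma eigenvalue_exp_le_trace A a N : A^T = A -> ~~ odd N ->
  eigenvalue A a -> a ^+ N <= \tr (A ^+ N).
Proof.
move=> sA evN /eigenvalueP[v vA v0].
have vAk k : v *m A ^+ k = a ^+ k *: v.
  elim: k => [|k IH]; first by rewrite !expr0 mulmx1 scale1r.
  by rewrite exprSr -mulmxE mulmxA IH -scalemxAl vA scalerA -exprSr.
rewrite -(odd_double_half N) (negbTE evN) add0n -addnn.
set k := N./2; set B := A ^+ k; have sB : B^T = B by exact: trmx_exp.
have v_gt0 : 0 < bform 1 v^T v^T.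
  rewrite lt0r bform1_ge0 andbT; apply: contraNneq v0 => /bform1_eq0 v0.
  by rewrite -[v]trmxK v0 trmx0.
rewrite -(ler_pM2r v_gt0).
have -> : a ^+ (k + k) * bform 1 v^T v^T = bform 1 (v *m B)^T (v *m B)^T.
  rewrite vAk /bform !mulmx1 !trmxK linearZ /= -scalemxAl -scalemxAr.
  by rewrite !mxtraceZ mulrA exprD.
have -> : \tr (A ^+ (k + k)) = \sum_i bform 1 (col i B) (col i B).
  rewrite exprD -/B -{1}sB; apply: eq_bigr => i _.
  by rewrite bform1_sum mxE; apply: eq_bigr => j _; rewrite !mxE expr2.
rewrite bform1_sum mulr_suml; apply: ler_sum => i _.
have -> : (v *m B)^T i 0 = bform 1 (col i B) v^T.
  by rewrite /bform mulmx1 trace_mx11 !mxE; apply: eq_bigr => j _; rewrite !mxE mulrC.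
exact: bform_CS (@psd1 _ _).
Qed.
End SymmetricEigenvalues.

(** The spectrum is nonempty by [symmetric_eigenvalue], so that its infimum is
    at least 1 - eps and not the default value 0. *)
Lemma well_conditioned_spectrum (R : realType) (m c : nat) (B : 'M[R]_(m, c))
    (eps : R) : (0 < m)%N -> 0 < eps < 1 ->
  (forall a, eigenvalue (B *m B^T) a -> 1 - eps <= a <= 1 + eps) ->
  0 < sigma_min B /\ kappa B <= Num.sqrt (1 + eps) / Num.sqrt (1 - eps).
Proof.
move=> m_gt0 /andP[e0 e1] ev.
have [a0 ea0] : exists a, eigenvalue (B *m B^T) a.
  by apply: symmetric_eigenvalue => //; rewrite trmx_mul trmxK.
have inf_ge : 1 - eps <= inf (spectrum (B *m B^T)).
  by apply: lb_le_inf; [exists a0 | move=> a /ev/andP[]].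
have sup_le : sup (spectrum (B *m B^T)) <= 1 + eps.
  by apply: ge_sup; [exists a0 | move=> a /ev/andP[]].
have smin : Num.sqrt (1 - eps) <= sigma_min B by rewrite ler_wsqrtr.
have smax : sigma_max B <= Num.sqrt (1 + eps) by rewrite ler_wsqrtr.
have s0 : 0 < Num.sqrt (1 - eps) by rewrite sqrtr_gt0; lra.
have s1 : 0 < sigma_min B by exact: lt_le_trans smin.
split=> //; rewrite /kappa ler_pM ?sqrtr_ge0 ?invr_ge0 ?sqrtr_ge0 //.
by rewrite lef_pV2.
Qed.

(** * Scalar estimates *)

Section ScalarEstimates.
Variable R : realType.

Lemma bernoulli (u : R) N : 0 <= u <= 1 -> 1 - N%:R * u <= (1 - u) ^+ N.
Proof.
move=> /andP[u0 u1]; elim: N => [|N IH]; first by rewrite mul0r subr0 expr0.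
have h : 0 <= 1 - u by lra.
rewrite exprS; apply: (le_trans _ (ler_wpM2l h IH)).
rewrite -natr1; have : 0 <= N%:R * u * u by rewrite !mulr_ge0.
lra.
Qed.

(** Quantitative form of (1 + y / N)^N --> exp y: with u = y / N, the
    inequality (1 - u) exp u <= 1 yields (1 - u^2) exp u <= 1 + u. *)
Lemma expR_le_pow (y : R) N : `|y| < N%:R ->
  expR y * (1 - y ^+ 2 / N%:R) <= (1 + y / N%:R) ^+ N.
Proof.
move=> yN; have N0 : 0 < N%:R :> R by exact: le_lt_trans yN.
set u := y / N%:R.
have /andP[u1 u2] : -1 < u < 1.
  by rewrite -ltr_norml normrM normfV (ger0_norm (ltW N0)) ltr_pdivrMr // mul1r.
have -> : y = u * N%:R by rewrite /u divfK // gt_eqF.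
have uu : 0 <= u ^+ 2 <= 1.
  by rewrite sqr_ge0 expr2 /=; nra.
have -> : (u * N%:R) ^+ 2 / N%:R = N%:R * u ^+ 2 by field; rewrite gt_eqF.
apply: (@le_trans _ _ (expR (u * N%:R) * (1 - u ^+ 2) ^+ N)).
  by rewrite ler_wpM2l ?expR_ge0 // bernoulli.
rewrite mulrC expRM_natr -exprMn; apply: lerXn2r; rewrite ?nnegrE.
- by rewrite mulr_ge0 ?expR_ge0 //; lra.
- lra.
have e := expR_ge1Dx (- u); rewrite expRN in e.
have e0 := expR_gt0 u.
have e1 : (1 - u) * expR u <= 1.
  by rewrite -(ler_pM2r e0) mulVf ?gt_eqF // in e.
have -> : 1 - u ^+ 2 = (1 + u) * (1 - u) by ring.
by rewrite -mulrA -[leRHS]mulr1 ler_wpM2l //; lra.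
Qed.

(** Used to let the degree N of the potential tend to infinity. *)
Lemma le_of_le_one_sub_inv (p b K : R) :
  (forall N0, exists2 N, (N0 < N)%N & p * (1 - K / N%:R) <= b) -> p <= b.
Proof.
move=> h; rewrite leNgt; apply/negP => bp.
have d0 : 0 < p - b by rewrite subr_gt0.
have [N /= NK] := h (Num.truncn (`|p * K| / (p - b))).+1.
have : `|p * K| / (p - b) < N%:R.
  by apply: (lt_trans (truncnS_gt _)); rewrite ltr_nat.
rewrite ltr_pdivrMr // => pK.
have N0 : 0 < N%:R :> R by rewrite ltr0n; exact: leq_ltn_trans NK.
have -> : p * (1 - K / N%:R) = p - p * K / N%:R by rewrite mulrBr mulr1 mulrA.
have : p * K / N%:R < p - b.
  by rewrite ltr_pdivrMr // [ltRHS]mulrC; exact: le_lt_trans (ler_norm _) pK.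
lra.
Qed.

(** The Legendre transform at 1 + eps of theta |-> exp theta - 1, that is, the
    large deviation rate of a Poisson variable of mean 1. *)
Definition chernoff_rate (eps : R) : R := (1 + eps) * ln (1 + eps) - eps.

Lemma le_of_derive_ge0 (F G : R -> R) (x : R) : 0 <= x ->
  (forall y, 0 <= y <= x -> is_derive y 1 F (G y)) ->
  (forall y, 0 <= y <= x -> 0 <= G y) -> F 0 <= F x.
Proof.
move=> x0 dF G0.
have itv y : y \in `]0, x[ -> 0 <= y <= x.
  by rewrite in_itv /= => /andP[/ltW-> /ltW->].
apply: (@ger0_derive1_ndecr R F 0 x) => //.
- by move=> y /itv/dF d; exact: ex_derive.
- by move=> y /itv yx; rewrite derive1E; have d := dF _ yx; rewrite derive_val; exact: G0.
- apply: derivable_within_continuous => y; rewrite in_itv /= => /dF d.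
  exact: ex_derive.
Qed.

Lemma is_derive_ln1D (y : R) : 0 < 1 + y ->
  is_derive y 1 (fun z => ln (1 + z)) (1 + y)^-1.
Proof.
move=> y0; have dl := is_derive1_ln y0.
have d : is_derive y 1 (fun z : R => 1 + z) 1.
  by apply: is_derive_eq; rewrite /GRing.scale /=; ring.
rewrite -[(1 + y)^-1]mulr1.
exact: (@is_derive1_comp _ (@ln R) (fun z : R => 1 + z)).
Qed.

Lemma is_derive_ln1B (y : R) : 0 < 1 - y ->
  is_derive y 1 (fun z => ln (1 - z)) (- (1 - y)^-1).
Proof.
move=> y0; have dl := is_derive1_ln y0.
have d : is_derive y 1 (fun z : R => 1 - z) (-1).
  by apply: is_derive_eq; rewrite /GRing.scale /=; ring.
rewrite -[(1 - y)^-1]mulr1 -mulrN.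
exact: (@is_derive1_comp _ (@ln R) (fun z : R => 1 - z)).
Qed.

Lemma chernoff_rate_upper (x : R) : 0 <= x -> chernoff_rate x <= x ^+ 2 / 2.
Proof.
move=> x0; rewrite /chernoff_rate.
pose F (y : R) : R := y + y ^+ 2 / 2 - (1 + y) * ln (1 + y).
suff : F 0 <= F x by rewrite /F addr0 ln1 mulr0 expr0n /=; lra.
apply: (@le_of_derive_ge0 F (fun y => y - ln (1 + y))) => // y /andP[y0 _].
  have y1 : 0 < 1 + y by lra.
  have d := is_derive_ln1D y1.
  apply: is_derive_eq.
  rewrite /GRing.scale /=; field; lra.
by rewrite subr_ge0 le_ln1Dx //; lra.
Qed.

(** Truncation of the series of 2 artanh u; the derivative of the difference is
    2 u^6 / (1 - u^2). *)
Lemma ln_ratio_lower (u : R) : 0 <= u < 1 ->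
  2 * u + 2 / 3 * u ^+ 3 + 2 / 5 * u ^+ 5 <= ln (1 + u) - ln (1 - u).
Proof.
move=> /andP[u0 u1].
pose F (y : R) : R := ln (1 + y) - ln (1 - y)
   - (2 * y + 2 / 3 * y ^+ 3 + 2 / 5 * y ^+ 5).
suff : F 0 <= F u.
  by rewrite /F addr0 subr0 ln1 !expr0n /= !mulr0 !addr0 !subr0; lra.
apply: (@le_of_derive_ge0 F (fun y => 2 * y ^+ 6 / (1 - y ^+ 2))) => //.
  move=> y /andP[y0 yu].
  have y1 : 0 < 1 + y by lra.
  have y2 : 0 < 1 - y by lra.
  have d1 := is_derive_ln1D y1.
  have d2 := is_derive_ln1B y2.
  apply: is_derive_eq.
  rewrite /GRing.scale /=; field; nra.
move=> y /andP[y0 yu]; have y6 : 0 <= y ^+ 6 by rewrite exprn_ge0.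
by rewrite divr_ge0 ?mulr_ge0 //; nra.
Qed.

(** The constant is sharp up to 0.5 percent at x = 1, where the rate is
    2 ln 2 - 1, so ln (1 + x) is expanded in u = x / (2 + x) <= 1 / 3, for which
    three terms of the series suffice. *)
Lemma chernoff_rate_lower (x : R) : 0 < x < 1 ->
  x ^+ 2 * (5 / 13) <= chernoff_rate x.
Proof.
move=> /andP[x0 x1]; rewrite /chernoff_rate.
set u := x / (2 + x).
have u0 : 0 < u by rewrite /u divr_gt0 //; lra.
have u1 : u < 1 / 3 by rewrite /u ltr_pdivrMr; lra.
have xE : x = 2 * u / (1 - u) by rewrite /u; field; lra.
have lnE : ln (1 + x) = ln (1 + u) - ln (1 - u).
  rewrite -ln_div ?posrE; try lra.
  by congr ln; rewrite xE; field; lra.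
have := @ln_ratio_lower u.
rewrite lnE; set l := ln _ - ln _ => /(_ _) lb.
have {}lb : 2 * u + 2 / 3 * u ^+ 3 + 2 / 5 * u ^+ 5 <= l by apply: lb; lra.
have w0 : 0 < 1 - u by lra.
have -> : 1 + x = (1 + u) / (1 - u) by rewrite xE; field; lra.
apply: (@le_trans _ _ ((1 + u) / (1 - u) *
    (2 * u + 2 / 3 * u ^+ 3 + 2 / 5 * u ^+ 5) - x)); last first.
  by rewrite lerD2r ler_wpM2l // divr_ge0; lra.
rewrite -subr_ge0 xE.
have -> : (1 + u) / (1 - u) * (2 * u + 2 / 3 * u ^+ 3 + 2 / 5 * u ^+ 5)
    - 2 * u / (1 - u) - (2 * u / (1 - u)) ^+ 2 * (5 / 13) =
  2 * u ^+ 2 / (1 - u) ^+ 2 *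
    (3 / 13 - (2 / 3 * u + 2 / 15 * u ^+ 3 + 1 / 5 * u ^+ 5)).
  by field; lra.
apply: mulr_ge0; first by rewrite divr_ge0 ?sqr_ge0 // mulr_ge0 ?sqr_ge0.
have p k : u ^+ k <= (1 / 3) ^+ k by apply: lerXn2r; rewrite ?nnegrE; lra.
have := p 3%N; have := p 5%N.
lra.
Qed.
End ScalarEstimates.

(** * Trace inequalities and sums over tuples *)

Section TraceInequalities.
Variables (R : realType) (m : nat).
Implicit Types A C : 'M[R]_m.

(** The diagonal entries of C^T A C are values of the form A at the columns of C. *)
Lemma psd_trace_ge0 A C : psd A -> 0 <= \tr (C^T *m A *m C).
Proof.
move=> [_ pA]; apply: sumr_ge0 => i _; have := pA (col i C).
rewrite /bform tr_col -row_mul trace_mx11 !mxE.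
by under eq_bigr do rewrite !mxE; under [X in _ -> 0 <= X]eq_bigr do rewrite !mxE.
Qed.

(** Equivalently tr (A^N - al^N) (A - al) >= 0, as for numbers.  The increment
    of the induction is tr (A - al) A^N (A - al) >= 0. *)
Lemma trace_chebyshev A (al : R) N : psd A -> 0 <= al ->
  al * \tr (A ^+ N) - \tr (A ^+ N.+1) <= al ^+ N * (al * m%:R - \tr A).
Proof.
move=> pA al0; elim: N => [|N IH].
  by rewrite !expr0 expr1 mul1r mxtrace1.
have sA : A^T = A by case: pA.
have := psd_trace_ge0 (A - al%:M) (psd_exp N pA).
have -> : (A - al%:M)^T = A - al%:M by rewrite linearB /= tr_scalar_mx sA.
rewrite mulmxBl !mulmxBr !mulmxBl !mul_scalar_mx !mul_mx_scalar.
rewrite -scalemxAl mulmxE -!exprS -!exprSr !linearB /= !mxtraceZ => h.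
have := ler_wpM2l al0 IH; rewrite (exprS al); lra.
Qed.
End TraceInequalities.

Section TupleSums.
Variables (R : realType) (n : nat).

Lemma sum_tuple_cons k (F : k.+1.-tuple 'I_n -> R) :
  \sum_s F s = \sum_(s : k.-tuple 'I_n) \sum_i F [tuple of i :: s].
Proof.
rewrite exchange_big pair_big /=.
rewrite (reindex (fun q : 'I_n * k.-tuple 'I_n => [tuple of q.1 :: q.2])) //=.
exists (fun s => (thead s, [tuple of behead s])) => [[i s] _|s _] /=.
  by rewrite theadE; congr pair; apply: val_inj.
by rewrite -tuple_eta.
Qed.

Lemma sum_uniq_tuple_cons k (F : seq 'I_n -> R) :
  \sum_(s : k.+1.-tuple 'I_n | uniq s) F s =
  \sum_(s : k.-tuple 'I_n | uniq s) \sum_(i | i \notin s) F (i :: s).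
Proof.
rewrite [LHS]big_mkcond sum_tuple_cons [RHS]big_mkcond /=.
apply: eq_bigr => s _; rewrite -big_mkcond /=.
have [us|nus] := boolP (uniq s); first by apply: eq_bigl => i; rewrite andbT.
by apply: big_pred0 => i; rewrite andbF.
Qed.

Lemma sum_notin (s : seq 'I_n) (f : 'I_n -> R) : uniq s ->
  \sum_(i | i \notin s) f i = \sum_i f i - \sum_(i <- s) f i.
Proof.
move=> us; rewrite (bigID (mem s) xpredT) /= (big_uniq _ us) /=.
by rewrite addrAC subrr add0r.
Qed.

Lemma sum_notin_const (s : seq 'I_n) (a : R) : uniq s ->
  \sum_(i | i \notin s) a = (n%:R - (size s)%:R) * a.
Proof.
move=> us; rewrite sum_notin // sumr_const card_ord big_const_seq count_predT.
by rewrite iter_addr_0 mulrBl !mulr_natl.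
Qed.

Lemma sum_uniq_tuple1 k : (k <= n)%N ->
  \sum_(s : k.-tuple 'I_n | uniq s) 1 = (n ^_ k)%:R :> R.
Proof.
elim: k => [|k IH] kn.
  rewrite ffactn0 big_mkcond (big_pred1 [tuple]) //= => s.
  by apply/esym/eqP; exact: tuple0.
rewrite (sum_uniq_tuple_cons k (fun=> 1)) ffactnSr natrM -IH 1?ltnW // mulr_suml.
apply: eq_bigr => s us; rewrite sum_notin_const // size_tuple mul1r mulr1.
by rewrite natrB // ltnW.
Qed.

(** Each of the k entries of a uniform sequence of distinct indices is uniform;
    multiplied by n to avoid a division. *)
Lemma sum_uniq_tuple_mean k (f : 'I_n -> R) : (k <= n)%N ->
  n%:R * (\sum_(s : k.-tuple 'I_n | uniq s) \sum_(i <- s) f i) =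
  k%:R * (n ^_ k)%:R * \sum_i f i.
Proof.
elim: k => [|k IH] kn.
  by rewrite !mul0r big1 ?mulr0 // => s _; rewrite tuple0 big_nil.
rewrite (sum_uniq_tuple_cons k (fun s => \sum_(i <- s) f i)).
have step (s : k.-tuple 'I_n) : uniq s ->
    \sum_(i | i \notin s) \sum_(j <- i :: s) f j =
    \sum_i f i + (n%:R - k%:R - 1) * \sum_(i <- s) f i.
  move=> us; under eq_bigr do rewrite big_cons.
  rewrite big_split /= sum_notin // sum_notin_const // size_tuple; ring.
rewrite (eq_bigr _ step) big_split /= -mulr_sumr mulrDr mulrCA IH 1?ltnW //.
rewrite -[X in \sum_(s : k.-tuple _ | _) X]mul1r -mulr_suml sum_uniq_tuple1 1?ltnW //.
rewrite ffactnSr natrM natrB 1?ltnW // -natr1; ring.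
Qed.
End TupleSums.

(** * The expected potential of a random Gram matrix *)

Section Potential.
Variables (R : realType) (m n c : nat) (x : 'I_n -> 'cV[R]_m).
Implicit Types (s : seq 'I_n) (r g : R) (N : nat).

Definition gram s : 'M[R]_m := \sum_(i <- s) x i *m (x i)^T.

Definition shifted r s : 'M[R]_m := 1 + r *: gram s.

Definition potential r N s : R := \tr (shifted r s ^+ N).

(** The property that one more draw increases the potential at most as
    Golden-Thompson predicts; the increment is factored as g r because its sign
    is that of r, which sampling without replacement exploits. *)
Definition potential_step r N g := forall s i, (size s < c)%N ->
  potential r N (i :: s) <=
    potential r N s + g * r * bform (shifted r s ^+ N) (x i) (x i).

(** All that the tail bounds need to know about the sampling scheme, so that they
    are proved once for sampling with and without replacement. *)
Definition controlled (law : seq 'I_n -> R) := forall r N g,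
  0 <= g -> -1 <= r ->
  (forall s, (size s <= c)%N -> psd (shifted r s)) ->
  potential_step r N g ->
  \sum_(s : c.-tuple 'I_n) law s * potential r N s <= m%:R * expR (g * r).

Lemma gram_cons i s : gram (i :: s) = x i *m (x i)^T + gram s.
Proof. by rewrite /gram big_cons. Qed.

Lemma gram_sym s : (gram s)^T = gram s.
Proof.
rewrite /gram raddf_sum /=; apply: eq_bigr => i _.
by rewrite trmx_mul trmxK.
Qed.

Lemma shifted_sym r s : (shifted r s)^T = shifted r s.
Proof. by rewrite /shifted linearD linearZ /= trmx1 gram_sym. Qed.

Lemma shifted_cons r i s :
  shifted r (i :: s) = shifted r s + r *: (x i *m (x i)^T).
Proof. by rewrite /shifted gram_cons scalerDr addrA addrAC. Qed.

Lemma mxtrace_gramM (B : 'M[R]_m) s :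
  \tr (B *m gram s) = \sum_(i <- s) bform B (x i) (x i).
Proof.
rewrite /gram mulmx_sumr raddf_sum /=; apply: eq_bigr => i _.
exact: mxtrace_bform.
Qed.

Section Hypotheses.
Variables (r g : R) (N : nat).
Hypothesis psd_shifted : forall s, (size s <= c)%N -> psd (shifted r s).
Hypothesis step : potential_step r N g.

Lemma potential_ge0 s : (size s <= c)%N -> 0 <= potential r N s.
Proof.
move=> sc; have := psd_trace_ge0 1 (psd_exp N (psd_shifted sc)).
by rewrite mulmx1 trmx1 mul1mx.
Qed.

Lemma potential_nil : potential r N [::] = m%:R.
Proof.
by rewrite /potential /shifted /gram big_nil scaler0 addr0 expr1n mxtrace1.
Qed.

Lemma expected_potential_replacement (p : 'I_n -> R) k :
  (forall i, 0 <= p i) -> \sum_i p i = 1 ->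
  \sum_i p i *: (x i *m (x i)^T) = c%:R^-1 *: 1%:M -> (k <= c)%N ->
  \sum_(s : k.-tuple 'I_n) (\prod_(i <- s) p i) * potential r N s <=
    m%:R * expR (g * r / c%:R) ^+ k.
Proof.
move=> p0 p1 px; elim: k => [|k IH] kc.
  rewrite (big_pred1 [tuple]) => [|s]; last by apply/esym/eqP; exact: tuple0.
  by rewrite big_nil mul1r potential_nil expr0 mulr1.
rewrite sum_tuple_cons exprSr mulrA.
apply: le_trans (ler_wpM2r (expR_ge0 _) (IH (ltnW kc))).
rewrite mulr_suml; apply: ler_sum => s _.
have sc : (size s < c)%N by rewrite size_tuple.
under [leLHS]eq_bigr do rewrite /= big_cons mulrAC mulrC.
rewrite -mulr_sumr -[leRHS]mulrA; apply: ler_wpM2l; first by rewrite prodr_ge0.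
apply: (@le_trans _ _ (\sum_i p i * (potential r N s +
   g * r * bform (shifted r s ^+ N) (x i) (x i)))).
  by apply: ler_sum => i _; rewrite ler_wpM2l //; exact: step.
under eq_bigr do rewrite mulrDr mulrCA.
rewrite big_split /= -mulr_suml p1 mul1r -mulr_sumr.
have -> : \sum_i p i * bform (shifted r s ^+ N) (x i) (x i) =
    c%:R^-1 * potential r N s.
  rewrite -[potential r N s]/(\tr (shifted r s ^+ N)) -mxtraceZ.
  rewrite -[X in \tr (_ *: X)]mulmx1 scalemxAr -px mulmx_sumr raddf_sum /=.
  by apply: eq_bigr => i _; rewrite -scalemxAr mxtraceZ mxtrace_bform.
rewrite mulrA -[X in X + _]mul1r -mulrDl mulrC; apply: ler_wpM2l.
  exact/potential_ge0/ltnW.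
exact: expR_ge1Dx.
Qed.

(** Given the first k indices, summing x x^T over the n - k remaining ones gives
    n / c - G.  Writing r G = A - 1, the deviation of its contribution from the
    one with replacement is g (al tr A^N - tr A^(N+1)) with al = 1 + r k / c.
    By [trace_chebyshev] it is at most g al^N (al m - tr A), which sums to zero
    over all sequences of k distinct indices. *)
Lemma expected_potential_uniq k :
  0 <= g -> -1 <= r -> (0 < c <= n)%N ->
  \sum_i x i *m (x i)^T = (n%:R / c%:R) *: 1%:M -> (k <= c)%N ->
  \sum_(s : k.-tuple 'I_n | uniq s) potential r N s <=
    (n ^_ k)%:R * (m%:R * expR (g * r / c%:R) ^+ k).
Proof.
move=> g0 r1 /andP[c0 cn] xx.
have cR0 : 0 < c%:R :> R by rewrite ltr0n.
elim: k => [|k IH] kc.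
  rewrite big_mkcond (big_pred1 [tuple]) /= => [|s]; last first.
    by apply/esym/eqP; exact: tuple0.
  by rewrite potential_nil ffactn0 expr0 mulr1 mul1r.
have kn : (k < n)%N := leq_trans kc cn.
rewrite (sum_uniq_tuple_cons k (potential r N)).
pose al : R := 1 + r * k%:R / c%:R.
have al0 : 0 <= al.
  have k1 : k%:R / c%:R <= 1 :> R.
    by rewrite ler_pdivrMr // mul1r ler_nat ltnW.
  have k0 : 0 <= k%:R / c%:R :> R by rewrite divr_ge0.
  rewrite /al -mulrA; nra.
have stepS (s : k.-tuple 'I_n) : uniq s ->
    \sum_(i | i \notin s) potential r N (i :: s) <=
    (n%:R - k%:R) * (1 + g * r / c%:R) * potential r N s +
    g * al ^+ N * (r * (k%:R * m%:R / c%:R - \tr (gram s))).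
  move=> us; have sc : (size s < c)%N by rewrite size_tuple.
  set A := shifted r s.
  apply: (@le_trans _ _ (\sum_(i | i \notin s) (potential r N s +
     g * r * bform (A ^+ N) (x i) (x i)))).
    by apply: ler_sum => i _; exact: step.
  rewrite big_split /= sum_notin_const // size_tuple -mulr_sumr sum_notin //.
  rewrite -mxtrace_gramM.
  have -> : \sum_i bform (A ^+ N) (x i) (x i) = n%:R / c%:R * potential r N s.
    rewrite -[potential r N s]/(\tr (A ^+ N)) -mxtraceZ.
    rewrite -[X in \tr (_ *: X)]mulmx1 scalemxAr -xx mulmx_sumr raddf_sum /=.
    by apply: eq_bigr => i _; rewrite mxtrace_bform.
  have trG : r * \tr (A ^+ N *m gram s) = \tr (A ^+ N.+1) - potential r N s.
    rewrite exprSr -[X in _ = _ - X]/(\tr (A ^+ N)) {2}/A /shifted -mulmxE.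
    by rewrite mulmxDr mulmx1 -scalemxAr mxtraceD mxtraceZ addrAC subrr add0r.
  have trA : \tr A = m%:R + r * \tr (gram s).
    by rewrite /A /shifted mxtraceD mxtraceZ mxtrace1.
  have := trace_chebyshev N (psd_shifted (ltnW sc)) al0.
  rewrite -/A -[\tr (A ^+ N)]/(potential r N s) trA => /(ler_wpM2l g0).
  set P := potential r N s; set Q := \tr (A ^+ N.+1) in trG *.
  set W := \tr (A ^+ N *m gram s) in trG *.
  set H := al ^+ N; set T := \tr (gram s) => h.
  rewrite -subr_ge0; set d := (X in 0 <= X).
  have -> : d = g * (H * (al * m%:R - (m%:R + r * T))) - g * (al * P - Q).
    have -> : Q = r * W + P by rewrite trG subrK.
    by rewrite /d /al; field; exact: lt0r_neq0.
  by rewrite subr_ge0.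
apply: (@le_trans _ _ (\sum_(s : k.-tuple 'I_n | uniq s)
    ((n%:R - k%:R) * (1 + g * r / c%:R) * potential r N s +
    g * al ^+ N * (r * (k%:R * m%:R / c%:R - \tr (gram s)))))).
  by apply: ler_sum => s; exact: stepS.
rewrite big_split /= -!mulr_sumr.
have -> : \sum_(s : k.-tuple 'I_n | uniq s) (k%:R * m%:R / c%:R - \tr (gram s)) = 0 :> R.
  have trg s : \tr (gram s) = \sum_(i <- s) bform 1 (x i) (x i).
    by rewrite -mxtrace_gramM mul1mx.
  under eq_bigr do rewrite trg.
  have n0 : n%:R != 0 :> R by rewrite pnatr_eq0 -lt0n (leq_ltn_trans _ kn).
  apply: (mulfI n0); rewrite mulr0 sumrB mulrBr sum_uniq_tuple_mean 1?ltnW //.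
  have -> : \sum_i bform 1 (x i) (x i) = n%:R * m%:R / c%:R.
    transitivity (\tr (\sum_i x i *m (x i)^T)).
      by rewrite raddf_sum /=; apply: eq_bigr => i _; rewrite -mxtrace_bform mul1mx.
    by rewrite xx mxtraceZ mxtrace1 mulrAC.
  rewrite -[X in \sum_(_ | _) X]mul1r -mulr_suml sum_uniq_tuple1 1?ltnW //.
  by field; exact: lt0r_neq0.
rewrite !mulr0 addr0 ffactnSr natrM natrB 1?ltnW // exprSr.
set E := expR _; set S := \sum_(_ | _) _.
(* 1 + g r / c could be negative; replacing it by its exponential is
   harmless since S >= 0. *)
have nk0 : 0 <= n%:R - k%:R :> R by rewrite subr_ge0 ler_nat ltnW.
have S0 : 0 <= S.
  by apply: sumr_ge0 => s _; apply: potential_ge0; rewrite size_tuple ltnW.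
rewrite [leRHS](_ : _ = (n%:R - k%:R) * ((n ^_ k)%:R * (m%:R * E ^+ k) * E)); last by ring.
rewrite -[leLHS]mulrA; apply: ler_wpM2l => //.
apply: (le_trans (ler_wpM2r S0 (expR_ge1Dx _))); rewrite mulrC.
by apply: ler_wpM2r (IH (ltnW kc)); exact: expR_ge0.
Qed.
End Hypotheses.

Lemma controlled_replacement (p : 'I_n -> R) :
  (0 < c)%N -> (forall i, 0 <= p i) -> \sum_i p i = 1 ->
  \sum_i p i *: (x i *m (x i)^T) = c%:R^-1 *: 1%:M ->
  controlled (fun s => \prod_(i <- s) p i).
Proof.
move=> c0 p0 p1 px r N g _ _ pA st.
apply: (le_trans (expected_potential_replacement pA st p0 p1 px (leqnn c))).
by rewrite -expRM_natr divfK // pnatr_eq0 -lt0n.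
Qed.

Lemma controlled_no_replacement :
  (0 < c <= n)%N -> \sum_i x i *m (x i)^T = (n%:R / c%:R) *: 1%:M ->
  controlled (fun s => if uniq s then (n ^_ c)%:R^-1 else 0).
Proof.
move=> cn xx r N g g0 r1 pA st.
have nc0 : 0 < (n ^_ c)%:R :> R by rewrite ltr0n ffact_gt0; case/andP: cn.
have := expected_potential_uniq pA st g0 r1 cn xx (leqnn c).
rewrite -expRM_natr divfK; last by rewrite pnatr_eq0 -lt0n; case/andP: cn.
rewrite mulrC -ler_pdivrMr // mulrC mulr_sumr; apply: le_trans.
rewrite [leRHS]big_mkcond; apply: ler_sum => s _.
by case: ifP => _; rewrite ?mul0r.
Qed.
End Potential.

(** * Chernoff tails for extreme eigenvalues *)

Lemma exists_even_nat (R : realType) (b : R) N0 :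
  exists N, [/\ (N0 < N)%N, ~~ odd N & b < N%:R].
Proof.
exists (N0 + (Num.truncn b).+1).*2; split.
- by rewrite -addnn; lia.
- by rewrite odd_double.
apply: (lt_le_trans (truncnS_gt _)); rewrite ler_nat -addnn addnA.
exact: leq_addl.
Qed.

Section Tails.
Variables (R : realType) (m n c : nat) (x : 'I_n -> 'cV[R]_m).
Variables (law : seq 'I_n -> R) (ell eps : R).
Hypothesis law_ge0 : forall s, 0 <= law s.
Hypothesis law_controlled : controlled c x law.
Hypothesis ell_gt0 : 0 < ell.
Hypothesis x_bound : forall i, bform 1 (x i) (x i) <= ell.
Hypothesis eps_bounds : 0 < eps < 1.

Lemma bform_gram s y :
  bform (gram x s) y y = \sum_(i <- s) bform 1 (x i) y ^+ 2.
Proof.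
rewrite /gram bform_suml; apply: eq_bigr => i _.
rewrite expr2 {1}bformC ?trmx1 // /bform !mulmx1 -mxtrace_mul11.
by rewrite !mulmxA.
Qed.

Lemma bform_gram_ge0 s y : 0 <= bform (gram x s) y y.
Proof. by rewrite bform_gram sumr_ge0 // => i _; exact: sqr_ge0. Qed.

Lemma bform_gram_le s y :
  bform (gram x s) y y <= (size s)%:R * ell * bform 1 y y.
Proof.
rewrite bform_gram; elim: s => [|i s IH]; first by rewrite big_nil !mul0r.
rewrite big_cons /= -nat1r -mulrA mulrDl mul1r lerD //; last by rewrite mulrA.
apply: (le_trans (bform_CS _ _ (@psd1 _ _))).
by rewrite ler_wpM2r ?bform1_ge0.
Qed.

Lemma bform_shifted r s y :
  bform (shifted x r s) y y = bform 1 y y + r * bform (gram x s) y y.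
Proof. by rewrite /shifted bformDm bformZm. Qed.

(** On a bad outcome some eigenvalue a of the Gram matrix makes the potential at
    least (1 + r a)^N >= thr^N. *)
Lemma markov_potential (bad : pred (c.-tuple 'I_n)) r N g thr :
  0 <= g -> -1 <= r -> ~~ odd N ->
  (forall s, (size s <= c)%N -> psd (shifted x r s)) ->
  potential_step c x r N g -> 0 <= thr ->
  (forall s, bad s -> exists2 a, eigenvalue (gram x s) a & thr <= 1 + r * a) ->
  (\sum_(s | bad s) law s) * thr ^+ N <= m%:R * expR (g * r).
Proof.
move=> g0 r1 evN pA st thr0 badP.
apply: le_trans (law_controlled g0 r1 pA st).
rewrite mulr_suml [leLHS]big_mkcond; apply: ler_sum => s _.
have P0 : 0 <= potential x r N s by apply: (potential_ge0 N pA); rewrite size_tuple.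
case: ifPn => [/badP[a ea ta]|_]; last by rewrite mulr_ge0.
apply: ler_wpM2l => //.
apply: (@le_trans _ _ ((1 + r * a) ^+ N)).
  by apply: lerXn2r; rewrite ?nnegrE // (le_trans thr0).
apply: eigenvalue_exp_le_trace => //; first exact: shifted_sym.
exact: eigenvalue_shift.
Qed.

(** The minimizer of (exp (theta ell) - 1) / ell - theta (1 + eps) is
    theta = ln (1 + eps) / ell, with value - rate / ell. *)
Lemma upper_tail (bad : pred (c.-tuple 'I_n)) :
  (forall s, bad s -> exists2 a, eigenvalue (gram x s) a & 1 + eps < a) ->
  \sum_(s | bad s) law s <= m%:R * expR (- chernoff_rate eps / ell).
Proof.
move=> badP; have /andP[e0 e1] := eps_bounds; set p := \sum_(_ | _) _.
pose theta := ln (1 + eps) / ell; pose y := theta * (1 + eps).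
have th0 : 0 < theta by rewrite divr_gt0 // ln_gt0 // ltrDl.
have y0 : 0 < y by rewrite mulr_gt0 //; lra.
apply: (@le_of_le_one_sub_inv _ _ _ (y ^+ 2)) => N0.
have [N [NN0 evN NB]] := exists_even_nat y N0; exists N => //.
have NR0 : 0 < N%:R :> R := lt_trans y0 NB.
pose r := theta / N%:R; have r0 : 0 < r by rewrite divr_gt0.
pose g : R := \sum_(j < N) (1 + r * ell) ^+ j.
have rl0 : 0 <= 1 + r * ell by rewrite addr_ge0 // mulr_ge0 // ltW.
have g0 : 0 <= g by rewrite sumr_ge0 // => j _; rewrite exprn_ge0.
have A1 s z : bform 1 z z <= bform (shifted x r s) z z.
  by rewrite bform_shifted lerDl mulr_ge0 ?bform_gram_ge0 // ltW.
have pA s : psd (shifted x r s).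
  by split=> [|z]; [exact: shifted_sym | exact: le_trans (bform1_ge0 z) (A1 s z)].
have st : potential_step c x r N g.
  move=> s i _; rewrite /potential shifted_cons.
  apply: (le_trans (trace_rank_one_upper _ (pA s) N (ltW r0) (A1 s))).
  rewrite lerD2l [g * r]mulrC; apply: ler_wpM2r; first exact: moment_ge0.
  rewrite ler_wpM2l ?(ltW r0) //; apply: ler_sum => j _.
  apply: lerXn2r; rewrite ?nnegrE //.
    by rewrite addr_ge0 // mulr_ge0 ?bform1_ge0 // ltW.
  by rewrite lerD2l ler_wpM2l // ltW.
have bd s : bad s -> exists2 a, eigenvalue (gram x s) a & 1 + y / N%:R <= 1 + r * a.
  move=> /badP[a ea la]; exists a => //.
  by rewrite lerD2l /y mulrAC ler_wpM2l ?(ltW r0) // ltW.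
have thr0 : 0 <= 1 + y / N%:R by rewrite addr_ge0 // divr_ge0 // ltW.
have r1 : -1 <= r by lra.
have := markov_potential g0 r1 evN (fun s _ => pA s) st thr0 bd.
rewrite -/p => mk.
have p0 : 0 <= p by rewrite sumr_ge0.
have yN : `|y| < N%:R by rewrite gtr0_norm.
have gr : g * r <= eps / ell.
  rewrite ler_pdivlMr // -mulrA mulrC.
  have -> : r * ell * g = (1 + r * ell) ^+ N - 1.
    by rewrite subrX1 addrAC subrr add0r.
  rewrite lerBlDl.
  have -> : 1 + eps = expR (r * ell) ^+ N.
    rewrite -expRM_natr /r mulrAC divfK ?gt_eqF // /theta divfK ?gt_eqF //.
    by rewrite lnK // posrE; lra.
  by apply: lerXn2r; rewrite ?nnegrE ?expR_ge0 // expR_ge1Dx.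
rewrite -(ler_pM2r (expR_gt0 y)) -[leLHS]mulrA -[leRHS]mulrA.
apply: (@le_trans _ _ (p * (1 + y / N%:R) ^+ N)).
  by rewrite ler_wpM2l // mulrC; exact: expR_le_pow.
apply: (le_trans mk); rewrite -expRD ler_wpM2l // ler_expR.
apply: (le_trans gr); rewrite /y /theta /chernoff_rate.
by rewrite le_eqVlt; apply/orP; left; apply/eqP; field; exact: lt0r_neq0.
Qed.

(** Here theta = eps / ell minimizes - theta eps + theta^2 ell / 2.  The Gram
    matrix of at most c vectors is bounded by c ell, so that A = 1 + r G stays
    between kap = 1 - eps c / N and 1, and kap tends to 1 with N. *)
Lemma lower_tail (bad : pred (c.-tuple 'I_n)) :
  (forall s, bad s -> exists2 a, eigenvalue (gram x s) a & a < 1 - eps) ->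
  \sum_(s | bad s) law s <= m%:R * expR (- (eps ^+ 2 / 2) / ell).
Proof.
move=> badP; have /andP[e0 e1] := eps_bounds; set p := \sum_(_ | _) _.
have p0 : 0 <= p by rewrite sumr_ge0.
pose theta := eps / ell; pose y := - (theta * (1 - eps)).
(* D / N absorbs the replacement of kap by 1 in the exponent. *)
pose D := eps ^+ 3 * c%:R / ell.
have th0 : 0 < theta by rewrite divr_gt0.
have D0 : 0 <= D by rewrite divr_ge0 ?(ltW ell_gt0) // mulr_ge0 // exprn_ge0 // ltW.
apply: (@le_of_le_one_sub_inv _ _ _ (y ^+ 2 + D)) => N0.
(* The four terms ensure in turn r >= -1, kap >= 1 / 2, a nonnegative
   threshold 1 + y / N, and 1 - y^2 / N >= 0. *)
have [N [NN0 evN NB]] := exists_even_nat (theta + 2 * c%:R + `|y| + y ^+ 2) N0.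
exists N => //.
have c0 : 0 <= c%:R :> R by [].
have yy0 : 0 <= `|y| by [].
have y20 : 0 <= y ^+ 2 by exact: sqr_ge0.
have NR0 : 0 < N%:R :> R by lra.
pose r := - (theta / N%:R).
have r0 : r <= 0 by rewrite oppr_le0 divr_ge0 // ltW.
have r1 : -1 <= r by rewrite lerN2 ler_pdivrMr // mul1r; lra.
pose kap := 1 - eps * c%:R / N%:R.
have kap_half : 1 / 2 <= kap.
  have : eps * c%:R / N%:R <= 1 / 2 by rewrite ler_pdivrMr //; nra.
  rewrite /kap; lra.
have kap0 : 0 < kap by lra.
have rN : r * ell * N%:R = - eps.
  by rewrite /r /theta; field; rewrite !lt0r_neq0.
pose g := N%:R * (1 + r * ell * N%:R / (2 * kap)).
have g0 : 0 <= g.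
  rewrite /g rN mulr_ge0 // mulNr subr_ge0 ler_pdivrMr; lra.
have A1 s z : bform (shifted x r s) z z <= bform 1 z z.
  by rewrite bform_shifted gerDl mulr_le0_ge0 // bform_gram_ge0.
have Ak s z : (size s <= c)%N -> kap * bform 1 z z <= bform (shifted x r s) z z.
  move=> sc; rewrite bform_shifted /kap mulrBl mul1r lerD2l /r mulNr lerN2.
  rewrite mulrAC [leRHS]mulrAC ler_wpM2r ?invr_ge0 //.
  apply: (@le_trans _ _ (theta * ((size s)%:R * ell * bform 1 z z))).
    by rewrite ler_wpM2l ?bform_gram_le // ltW.
  rewrite [leLHS](_ : _ = eps * ((size s)%:R * bform 1 z z)).
    by rewrite -mulrA ler_wpM2l ?(ltW e0) // ler_wpM2r ?bform1_ge0 // ler_nat.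
  by rewrite /theta; field; exact: lt0r_neq0.
have pA s : (size s <= c)%N -> psd (shifted x r s).
  move=> sc; split=> [|z]; first exact: shifted_sym.
  by apply: (le_trans _ (Ak s z sc)); rewrite mulr_ge0 ?bform1_ge0 // ltW.
have st : potential_step c x r N g.
  move=> s i sc; have sc' := ltnW sc.
  have pB := pA (i :: s) sc; rewrite shifted_cons in pB.
  rewrite /potential shifted_cons [g * r]mulrC.
  apply: (trace_rank_one_lower (pA s sc') r0 kap0 pB (x_bound i)) => //.
  - by move=> z; exact: Ak.
  - by rewrite rN; lra.
have bd s : bad s -> exists2 a, eigenvalue (gram x s) a & 1 + y / N%:R <= 1 + r * a.
  move=> /badP[a ea la]; exists a => //.
  rewrite lerD2l /y /r !mulNr lerN2 mulrAC ler_wpM2r ?invr_ge0 //.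
  by rewrite ler_wpM2l // ltW.
have yN : `|y| < N%:R by lra.
have thr0 : 0 <= 1 + y / N%:R.
  have := ler_norm (- y); rewrite normrN => yl.
  have : - y / N%:R <= 1 by rewrite ler_pdivrMr // mul1r; lra.
  rewrite mulNr; lra.
have := markov_potential g0 r1 evN pA st thr0 bd; rewrite -/p => mk.
have expo : g * r - y <= - (eps ^+ 2 / 2) / ell + D / N%:R.
  have -> : g * r = - theta * (1 - eps / (2 * kap)).
    by rewrite /g rN /r; field; rewrite !lt0r_neq0.
  have kinv : kap^-1 <= 1 + 2 * (eps * c%:R / N%:R).
    rewrite -[kap^-1]mul1r ler_pdivrMr //.
    have : 0 <= eps * c%:R / N%:R by rewrite divr_ge0 // mulr_ge0 // ltW.
    move: kap_half; rewrite /kap; nra.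
  have -> : - theta * (1 - eps / (2 * kap)) - y =
     theta * eps * (kap^-1 / 2 - 1).
    by rewrite /y; field; rewrite lt0r_neq0.
  have -> : - (eps ^+ 2 / 2) / ell + D / N%:R =
     theta * eps * ((1 + 2 * (eps * c%:R / N%:R)) / 2 - 1).
    by rewrite /D /theta; field; rewrite !lt0r_neq0.
  have te0 : 0 <= theta * eps by rewrite mulr_ge0 // ltW.
  rewrite ler_wpM2l //; lra.
have yN2 : 0 <= 1 - y ^+ 2 / N%:R.
  by rewrite subr_ge0 ler_pdivrMr // mul1r; lra.
apply: (@le_trans _ _ (p * (1 - y ^+ 2 / N%:R) * expR (- (D / N%:R)))).
  apply: (@le_trans _ _ (p * (1 - y ^+ 2 / N%:R) * (1 - D / N%:R))).
    rewrite -mulrA ler_wpM2l //.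
    have : 0 <= y ^+ 2 / N%:R * (D / N%:R).
      by rewrite mulr_ge0 // divr_ge0.
    rewrite mulrDl; lra.
  by rewrite ler_wpM2l ?mulr_ge0 // expR_ge1Dx.
rewrite expRN ler_pdivrMr ?expR_gt0 // -[leRHS]mulrA -expRD.
rewrite -(ler_pM2r (expR_gt0 y)) -[leLHS]mulrA -[leRHS]mulrA.
apply: (@le_trans _ _ (p * (1 + y / N%:R) ^+ N)).
  by rewrite ler_wpM2l // mulrC; exact: expR_le_pow.
apply: (le_trans mk); rewrite -expRD ler_wpM2l // ler_expR -lerBlDr.
exact: expo.
Qed.
End Tails.

(** * From sampled indices to conditioning *)

Section SampleLaw.
Variables (R : realType) (d : measure_display) (T : measurableType d).
Variables (P : probability T R) (n c : nat) (t : 'I_c -> T -> 'I_n).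
Hypothesis t_RV : forall j, index_RV (t j).

Definition sample (w : T) : c.-tuple 'I_n := [tuple t j w | j < c].

Lemma sample_eqE (s : c.-tuple 'I_n) :
  [set w | sample w = s] = [set w | forall j, t j w = tnth s j].
Proof.
apply/seteqP; split=> w /=; first by move=> <- j; rewrite tnth_mktuple.
by move=> ws; apply: eq_from_tnth => j; rewrite tnth_mktuple.
Qed.

Lemma measurable_sample_eq (s : c.-tuple 'I_n) :
  measurable [set w | sample w = s].
Proof.
have -> : [set w | sample w = s] = \bigcap_(j in [set: 'I_c]) t j @^-1` [set tnth s j].
  by rewrite sample_eqE; apply/seteqP; split=> w /= h j; [move=> _|]; exact: h.
by apply: fin_bigcap_measurable => [|j _]; [exact: finite_finset | exact: t_RV].
Qed.

Lemma prob_sample (q : seq 'I_n -> R) (G : pred (c.-tuple 'I_n)) :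
  (forall s : c.-tuple 'I_n, P [set w | sample w = s] = (q s)%:E) ->
  P [set w | G (sample w)] = (\sum_(s | G s) q s)%:E.
Proof.
move=> Pq.
have -> : [set w | G (sample w)] =
    \bigcup_(s in [set s | G s]) [set w | sample w = s].
  by apply/seteqP; split=> w /= => [h|[s Gs ->]] //; exists (sample w).
rewrite measure_fin_bigcup.
- rewrite -(@bigfs _ _ _ _ (index_enum _) G) ?index_enum_uniq //; last first.
    by move=> s _; rewrite mem_index_enum.
  by rewrite -sumEFin; apply: eq_bigr => s _; exact: Pq.
- exact: finite_finset.
- by move=> s s' _ _ [w [/= -> ->]].
- by move=> s _; exact: measurable_sample_eq.
Qed.

Lemma prob_sample_replacement (p : 'I_n -> R) (s : c.-tuple 'I_n) :
  samples_with_replacement P p t ->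
  P [set w | sample w = s] = (\prod_(i <- s) p i)%:E.
Proof.
move=> [_ ind Pt]; rewrite sample_eqE.
have := ind finset.setT (fun j => [set tnth s j]) => /=.
have -> : [set w | forall j, j \in finset.setT -> t j w = tnth s j] =
    [set w | forall j, t j w = tnth s j].
  by apply/seteqP; split=> w /= h j => [|_]; apply: h; rewrite ?inE.
move=> ->; under eq_bigr do rewrite Pt.
rewrite prodEFin big_tuple; congr (_%:E); apply: eq_bigl => j.
by rewrite inE.
Qed.

Lemma prob_sample_no_replacement (s : c.-tuple 'I_n) :
  samples_without_replacement P t ->
  P [set w | sample w = s] = (if uniq s then (n ^_ c)%:R^-1 else 0)%:E.
Proof.
move=> [_ /(_ (finfun (tnth s)))]; rewrite sample_eqE.
have -> : [set w | forall j, t j w = [ffun j => tnth s j] j] =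
    [set w | forall j, t j w = tnth s j].
  by apply/seteqP; split=> w /= h j; move: (h j); rewrite ffunE.
move=> ->; congr ((if _ then _ else _)%:E).
by apply/injectiveP/tuple_uniqP => h j1 j2; move: (h j1 j2); rewrite !ffunE.
Qed.
End SampleLaw.

Section ScaledColumns.
Variables (R : realType) (m n c : nat) (Q : 'M[R]_(m, n)) (p : 'I_n -> R).
Hypothesis c_gt0 : (0 < c)%N.
Hypothesis p_ge0 : forall i, 0 <= p i.

Definition scaled_col (i : 'I_n) : 'cV[R]_m :=
  (Num.sqrt (c%:R * p i))^-1 *: col i Q.

Lemma norm2_sq (k : nat) (v : 'cV[R]_k) : norm2 v ^+ 2 = bform 1 v v.
Proof. by rewrite bform1_sum sqr_sqrtr // sumr_ge0 // => i _; exact: sqr_ge0. Qed.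

Lemma gram_sampling (s : c.-tuple 'I_n) :
  let QS := Q *m sampling_mx p (tnth s) in QS *m QS^T = gram scaled_col s.
Proof.
apply/matrixP => a b; rewrite /gram big_tuple summxE mxE; apply: eq_bigr => j _.
have QSE e : (Q *m sampling_mx p (tnth s) : 'M[R]_(m, c)) e j = scaled_col (tnth s j) e 0.
  rewrite mxE (bigD1 (tnth s j)) //= big1 ?addr0 => [|i /negbTE ij].
    by rewrite !mxE eqxx mul1r mulrC.
  by rewrite mxE ij mul0r mulr0.
by rewrite [RHS]mxE big_ord1 [X in _ = _ * X]mxE [X in _ * X = _]mxE !QSE.
Qed.

Lemma scaled_col_bound ell i : 0 <= ell ->
  norm2 (col i Q) ^+ 2 <= ell * (c%:R * p i) ->
  bform 1 (scaled_col i) (scaled_col i) <= ell.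
Proof.
move=> ell0 Ql; rewrite /scaled_col bformZr bformC ?trmx1 // bformZr -norm2_sq.
have cp : 0 <= c%:R * p i by rewrite mulr_ge0.
rewrite mulrA -expr2 exprVn sqr_sqrtr // mulrC.
move: cp; rewrite le0r => /orP[/eqP ->|cp]; first by rewrite invr0 mulr0.
by rewrite ler_pdivrMr.
Qed.

(** The rescaling makes the estimator unbiased; indices of weight 0 cause no
    bias because their columns vanish. *)
Lemma scaled_col_isotropic :
  Q *m Q^T = 1%:M -> (forall i, p i = 0 -> norm2 (col i Q) ^+ 2 = 0) ->
  \sum_i p i *: (scaled_col i *m (scaled_col i)^T) = c%:R^-1 *: 1%:M.
Proof.
move=> QQ p0; rewrite -QQ.
have -> : Q *m Q^T = \sum_i col i Q *m (col i Q)^T.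
  apply/matrixP => a b; rewrite summxE mxE; apply: eq_bigr => i _.
  by rewrite !mxE big_ord1 !mxE.
rewrite scaler_sumr; apply: eq_bigr => i _.
rewrite /scaled_col linearZ /= -scalemxAl -scalemxAr !scalerA.
have [pi0|pi0] := eqVneq (p i) 0.
  have -> : col i Q = 0 by apply/bform1_eq0; rewrite -norm2_sq p0.
  by rewrite mul0mx !scaler0.
congr (_ *: _); rewrite -mulrA -expr2 exprVn sqr_sqrtr ?mulr_ge0 //.
by field; rewrite pi0 pnatr_eq0 -lt0n c_gt0.
Qed.
End ScaledColumns.

Section Conditioning.
Variables (R : realType) (d : measure_display) (T : measurableType d).
Variables (P : probability T R) (m n c : nat) (t : 'I_c -> T -> 'I_n).
Variables (Q : 'M[R]_(m, n)) (p : 'I_n -> R) (eps delta ell : R).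
Variable law : seq 'I_n -> R.
Hypothesis m_gt0 : (0 < m)%N.
Hypothesis eps_bounds : 0 < eps < 1.
Hypothesis delta_bounds : 0 < delta < 1.

(** The rate of the lower tail is at least that of the upper tail
    ([chernoff_rate_upper]), so each tail receives delta / 2. *)
Lemma well_conditioned_prob :
  (forall j, index_RV (t j)) ->
  (forall s : c.-tuple 'I_n, P [set w | sample t w = s] = (law s)%:E) ->
  (forall s, 0 <= law s) ->
  controlled c (scaled_col c Q p) law ->
  0 < ell ->
  (forall i, bform 1 (scaled_col c Q p i) (scaled_col c Q p i) <= ell) ->
  ln (2 * m%:R / delta) <= chernoff_rate eps / ell ->
  ((1 - delta)%:E <= P (well_conditioned Q p t eps))%E.
Proof.
move=> tRV Plaw law0 ctl ell0 xb ln_le.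
have /andP[e0 e1] := eps_bounds; have /andP[d0 d1] := delta_bounds.
set x := scaled_col c Q p in ctl xb.
pose W (s : c.-tuple 'I_n) := `[< let QS := Q *m sampling_mx p (tnth s) in
  0 < sigma_min QS /\ kappa QS <= Num.sqrt (1 + eps) / Num.sqrt (1 - eps) >].
have -> : well_conditioned Q p t eps = [set w | W (sample t w)].
  have tE w : tnth (sample t w) = fun j => t j w.
    by apply/funext => j; rewrite tnth_mktuple.
  by apply/seteqP; split=> w /=; rewrite /W tE => /asboolP.
rewrite (prob_sample tRV W Plaw) lee_fin.
pose badU s := `[< exists2 a, eigenvalue (gram x s) a & 1 + eps < a >].
pose badL s := `[< exists2 a, eigenvalue (gram x s) a & a < 1 - eps >].
have bound : m%:R * expR (- chernoff_rate eps / ell) <= delta / 2.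
  have m0 : 0 < m%:R :> R by rewrite ltr0n.
  have q0 : 0 < 2 * m%:R / delta by rewrite divr_gt0 // mulr_gt0.
  have : expR (- chernoff_rate eps / ell) <= (2 * m%:R / delta)^-1.
    rewrite -[X in _ <= X^-1]lnK ?posrE // -expRN ler_expR mulNr lerN2.
    exact: ln_le.
  move=> /(ler_wpM2l (ltW m0)) h; apply: (le_trans h).
  by rewrite le_eqVlt; apply/orP; left; apply/eqP; field; rewrite !lt0r_neq0.
have hU : \sum_(s : c.-tuple 'I_n | badU s) law s <= delta / 2.
  apply: le_trans bound.
  apply: (upper_tail law0 ctl ell0 xb eps_bounds) => s.
  by move=> /asboolP.
have hL : \sum_(s : c.-tuple 'I_n | badL s) law s <= delta / 2.
  apply: le_trans bound.
  apply: (@le_trans _ _ (m%:R * expR (- (eps ^+ 2 / 2) / ell))).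
    apply: (lower_tail law0 ctl ell0 xb eps_bounds) => s.
    by move=> /asboolP.
  rewrite ler_wpM2l // ler_expR !mulNr lerN2 ler_wpM2r ?invr_ge0 ?(ltW ell0) //.
  exact: chernoff_rate_upper (ltW e0).
have total : \sum_(s : c.-tuple 'I_n) law s = 1.
  have := prob_sample tRV xpredT Plaw.
  have -> : [set w | xpredT (sample t w)] = [set: T] by apply/seteqP; split.
  by rewrite probability_setT => -[].
have : \sum_(s : c.-tuple 'I_n | ~~ W s) law s <= delta.
  apply: (@le_trans _ _ (\sum_(s : c.-tuple 'I_n | badU s) law s +
                         \sum_(s : c.-tuple 'I_n | badL s) law s)); last by lra.
  rewrite [leLHS]big_mkcond [X in _ <= X + _]big_mkcond [X in _ <= _ + X]big_mkcond.
  rewrite -big_split /=; apply: ler_sum => s _.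
  have l0 := law0 s.
  case: ifPn => [/asboolP nW|_]; last by case: ifP; case: ifP => _ _; lra.
  have [bU|nU] := boolP (badU s); first by case: ifP => _; lra.
  have [bL|nL] := boolP (badL s); first by lra.
  exfalso; apply: nW; apply: well_conditioned_spectrum => // a.
  rewrite gram_sampling -/x => ea; rewrite !leNgt; apply/andP; split.
    by apply/negP => ha; move/asboolP: nL; apply; exists a.
  by apply/negP => ha; move/asboolP: nU; apply; exists a.
by rewrite -total (bigID W xpredT) /=; lra.
Qed.
End Conditioning.

(** * Sample sizes and the theorem *)

Section Constants.
Variable R : realType.

Lemma c2_bounds (eps : R) : 0 < eps < 1 -> 2 <= c2 eps <= 26 / 10.
Proof.
move=> /[dup] eb /andP[e0 e1].
have lo := chernoff_rate_lower eb; have up := chernoff_rate_upper (ltW e0).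
have e20 : 0 < eps ^+ 2 by rewrite exprn_gt0.
have r0 : 0 < chernoff_rate eps by lra.
by rewrite /c2 -/(chernoff_rate eps) ler_pdivlMr // ler_pdivrMr //; lra.
Qed.

Lemma sample_size_rate (eps lg b c : R) : 0 < eps < 1 -> 0 < b ->
  c2 eps * b * (lg / eps ^+ 2) <= c -> lg <= chernoff_rate eps / (b / c).
Proof.
move=> /[dup] eb /andP[e0 e1] b0.
have lo := chernoff_rate_lower eb.
have e20 : 0 < eps ^+ 2 by rewrite exprn_gt0.
have r0 : 0 < chernoff_rate eps by lra.
rewrite /c2 -/(chernoff_rate eps) => h.
have -> : chernoff_rate eps / (b / c) = c * (chernoff_rate eps / b).
  by rewrite invf_div mulrCA mulrC.
rewrite -ler_pdivrMr ?divr_gt0 //; apply: le_trans h.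
by rewrite le_eqVlt; apply/orP; left; apply/eqP; field; rewrite !lt0r_neq0.
Qed.
End Constants.

Section OrthonormalRows.
Variables (R : realType) (m n : nat) (Q : 'M[R]_(m, n)).
Hypothesis QQ : Q *m Q^T = 1%:M.

Lemma sum_norm2_col : \sum_j norm2 (col j Q) ^+ 2 = m%:R.
Proof.
rewrite -(mxtrace1 R m) -QQ /mxtrace.
under eq_bigr do rewrite norm2_sq bform1_sum.
rewrite exchange_big; apply: eq_bigr => i _; rewrite mxE.
by apply: eq_bigr => j _; rewrite !mxE expr2.
Qed.

Lemma normF_sq : normF Q ^+ 2 = m%:R.
Proof.
rewrite sqr_sqrtr; last by do 2!(apply: sumr_ge0 => ? _); exact: sqr_ge0.
rewrite exchange_big -sum_norm2_col; apply: eq_bigr => j _.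
by rewrite norm2_sq bform1_sum; apply: eq_bigr => i _; rewrite mxE.
Qed.

(** The n squared column norms add up to m and are at most the coherence. *)
Lemma coherence_gt0 : (0 < m)%N -> 0 < n%:R * coherence Q.
Proof.
move=> m0; apply: (@lt_le_trans _ _ m%:R); first by rewrite ltr0n.
have -> : n%:R * coherence Q = \sum_(j < n) coherence Q.
  by rewrite sumr_const card_ord mulr_natl.
rewrite -sum_norm2_col.
by apply: ler_sum => j _; exact: le_bigmax.
Qed.
End OrthonormalRows.

Theorem theorem6p4 (R : realType) (m n c : nat) (Q : 'M[R]_(m, n))
    (eps delta : R) (d : measure_display) (T : measurableType d)
    (P : probability T R) (t : 'I_c -> T -> 'I_n)
    (m_gt0 : (0 < m)%N) (c_bounds : (1 <= c <= n)%N)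
    (Q_orthonormal : Q *m Q^T = 1%:M)
    (eps_bounds : 0 < eps < 1) (delta_bounds : 0 < delta < 1) :
  [/\ 2 <= c2 eps <= 26 / 10,
      forall (beta : R) (p : 'I_n -> R),
        0 < beta <= 1 ->
        prob_vector p ->
        (forall j, beta * norm2 (col j Q) ^+ 2 / normF Q ^+ 2 <= p j) ->
        c2 eps * m%:R * (ln (2 * m%:R / delta) / (beta * eps ^+ 2)) <= c%:R ->
        samples_with_replacement P p t ->
        ((1 - delta)%:E <= P (well_conditioned Q p t eps))%E
    & c2 eps * n%:R * coherence Q * (ln (2 * m%:R / delta) / eps ^+ 2) <= c%:R ->
      samples_with_replacement P (@uniform_weights R n) t \/
        samples_without_replacement P t ->
      ((1 - delta)%:E <= P (well_conditioned Q (@uniform_weights R n) t eps))%E].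
Proof.
have /andP[c0 cn] := c_bounds.
have cR0 : 0 < c%:R :> R by rewrite ltr0n.
have mR0 : 0 < m%:R :> R by rewrite ltr0n.
split; first exact: c2_bounds.
- move=> beta p /andP[b0 _] [p0 p1] lev size_c smp.
  rewrite normF_sq // in lev.
  have QP i : norm2 (col i Q) ^+ 2 <= m%:R / beta * p i.
    have := lev i; rewrite ler_pdivrMr // mulrC -ler_pdivlMr // => h.
    by rewrite mulrAC [m%:R * _]mulrC.
  have Q0 i : p i = 0 -> norm2 (col i Q) ^+ 2 = 0.
    move=> pi0; apply/eqP; rewrite eq_le sqr_ge0 andbT.
    by have := QP i; rewrite pi0 mulr0.
  have mb0 : 0 < m%:R / beta by rewrite divr_gt0.
  apply: (@well_conditioned_prob _ _ _ P _ _ _ _ _ _ _ _ (m%:R / beta / c%:R)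
      (fun s => \prod_(i <- s) p i)) => //.
  + by case: smp.
  + by move=> s; exact: prob_sample_replacement.
  + by move=> s; exact: prodr_ge0.
  + by apply: controlled_replacement => //; exact: scaled_col_isotropic.
  + exact: divr_gt0.
  + move=> i; apply: scaled_col_bound => //; first by rewrite ltW // divr_gt0.
    by rewrite mulrA divfK ?lt0r_neq0.
  + apply: sample_size_rate => //; apply: le_trans size_c.
    by rewrite le_eqVlt; apply/orP; left; apply/eqP; field; rewrite !lt0r_neq0 //;
      case/andP: eps_bounds.
- move=> size_c smp.
  have nR0 : 0 < n%:R :> R by rewrite ltr0n (leq_trans c0).
  have nmu0 := coherence_gt0 Q_orthonormal m_gt0.
  pose p := @uniform_weights R n.
  have pE i : p i = n%:R^-1 by [].
  have p0 i : 0 <= p i by rewrite pE invr_ge0.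
  have p1 : \sum_i p i = 1.
    by rewrite sumr_const card_ord -(mulr_natl n%:R^-1) divff ?lt0r_neq0.
  have iso : \sum_i p i *: (scaled_col c Q p i *m (scaled_col c Q p i)^T) =
      c%:R^-1 *: 1%:M.
    apply: scaled_col_isotropic => // i /eqP.
    by rewrite pE invr_eq0 gt_eqF.
  have xb i : bform 1 (scaled_col c Q p i) (scaled_col c Q p i) <=
      n%:R * coherence Q / c%:R.
    apply: scaled_col_bound => //; first by rewrite ltW // divr_gt0.
    rewrite mulrA divfK ?lt0r_neq0 // pE mulrAC divff ?lt0r_neq0 // mul1r.
    exact: le_bigmax.
  have rate : ln (2 * m%:R / delta) <=
      chernoff_rate eps / (n%:R * coherence Q / c%:R).
    by apply: sample_size_rate => //; rewrite (mulrA (c2 eps)).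
  have ell0 : 0 < n%:R * coherence Q / c%:R by rewrite divr_gt0.
  case: smp => smp.
  + apply: (well_conditioned_prob (law := fun s => \prod_(i <- s) p i)
      m_gt0 eps_bounds delta_bounds _
      (fun s => prob_sample_replacement s smp) _ _ ell0 xb rate).
    * by case: smp.
    * by move=> s; apply: prodr_ge0 => i _; exact: p0.
    * exact: controlled_replacement.
  + apply: (well_conditioned_prob
      (law := fun s => if uniq s then (n ^_ c)%:R^-1 else 0)
      m_gt0 eps_bounds delta_bounds _
      (fun s => prob_sample_no_replacement s smp) _ _ ell0 xb rate).
    * by case: smp.
    * by move=> s; case: ifP => // _; rewrite invr_ge0.
    * apply: controlled_no_replacement; first by rewrite c0.
      have := congr1 (fun M => n%:R *: M) iso; rewrite scalerA => <-.
      rewrite scaler_sumr; apply: eq_bigr => i _.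
      by rewrite pE scalerA divff ?lt0r_neq0 // scale1r.
Qed.
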